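(* Let $s>0$ and $b>2s$. If $\phi$ is a Hamiltonian diffeomorphism of $\mathbb{R}^2$ such that $\phi(L(s))\subset D(b)$, then $\phi(L(s))$ must intersect the family $$\bigcup_{t\in[s,b-s]}L(t).$$
   Context: $\mathbb{R}^2=\mathbb{C}$ carries its standard area form. A Hamiltonian diffeomorphism is the time-one map of the flow of a smooth, possibly time-dependent, Hamiltonian function. $D(b)=\{\pi|z|^2<b\}$ is the standard open disk of area $b$ and $L(t)=\{\pi|z|^2=t\}$ is the standard circle enclosing area $t$. *)

(* Defs.v *)
From HB Require Import structures.
From mathcomp Require Import all_boot all_order all_algebra.
From mathcomp Require Import all_classical all_reals all_analysis.

Set Implicit Arguments.
Unset Strict Implicit.
Unset Printing Implicit Defensive.

Import Order.TTheory GRing.Theory Num.Theory.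
Import numFieldNormedType.Exports.

Local Open Scope classical_set_scope.
Local Open Scope ring_scope.

(* Intended for finite-dimensional V, where the differential is of class C^k
   as soon as all its evaluations at fixed vectors are. *)
Fixpoint class_C (R : realType) (V W : normedModType R) (k : nat)
    (f : V -> W) : Prop :=
  if k is k'.+1 then
    (forall x, differentiable f x) /\
    (forall v, class_C k' (fun x => 'd f x v))
  else continuous f.

Definition smooth (R : realType) (V W : normedModType R) (f : V -> W) : Prop :=
  forall k, class_C k f.

Definition diffeomorphism (R : realType) (V W : normedModType R)
    (f : V -> W) : Prop :=
  smooth f /\ exists g : W -> V, [/\ cancel f g, cancel g f & smooth g].

(* Convention: the area form is dx /\ dy and X_h = (dh/dy, - dh/dx).  The
   opposite sign yields the same Hamiltonian diffeomorphisms (replace h by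
   - h). *)
Definition hamiltonian_vector_field (R : realType) (h : R * R -> R)
    (z : R * R) : R * R :=
  ('D_((0, 1) : R * R) h z, - 'D_((1, 0) : R * R) h z).

(* Only the values Phi t for t in [0, 1] matter, and the derivative at the two
   endpoints can be read as one-sided: extend each trajectory affinely
   outside [0, 1]. *)
Definition hamiltonian_flow (R : realType) (H : R * (R * R) -> R)
    (Phi : R -> R * R -> R * R) : Prop :=
  (forall z, Phi 0 z = z) /\
  (forall (z : R * R) (t : R), 0 <= t <= 1 ->
     is_derive t 1 (fun u => Phi u z)
       (hamiltonian_vector_field (fun w => H (t, w)) (Phi t z))).

(* H is not assumed to have compact support. *)
Definition hamiltonian_diffeomorphism (R : realType)
    (phi : R * R -> R * R) : Prop :=
  diffeomorphism phi /\
  exists (H : R * (R * R) -> R) (Phi : R -> R * R -> R * R),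
    [/\ smooth H, hamiltonian_flow H Phi & phi = Phi 1].

Definition open_disk (R : realType) (b : R) : set (R * R) :=
  [set z | pi * (z.1 ^+ 2 + z.2 ^+ 2) < b].

Definition circle (R : realType) (t : R) : set (R * R) :=
  [set z | pi * (z.1 ^+ 2 + z.2 ^+ 2) = t].

(* Main.v *)
(** The area form is exact, so the statement reduces to a degree argument for
    circulations.  A Hamiltonian diffeomorphism phi has Jacobian 1: along a
    trajectory the determinant of two difference vectors of size e changes by
    O(e^3), because the Hamiltonian vector field is divergence free, and one
    divides by e^2.

    Let psi be a plane map with Jacobian 1, and let G (rho) (x dy - y dx),
    rho = x^2 + y^2, be a 1-form on the target with
    d (rho G (rho)) / d rho in [0, 1] and rho G (rho) = c for rho >= sg.  The
    circulation I (r) of its pull-back along the circle of radius r satisfies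
    0 <= I' (r) <= 4 pi r by Green's theorem, and I (r) is c times an integer
    multiple of 2 pi as soon as psi maps that circle into {rho >= sg}.  So if
    psi maps both boundary circles of an annulus r0 <= |z| <= r1 into
    {rho >= sg}, but some interior point into {rho < sg}, then
    2 pi c <= 2 pi (r1^2 - r0^2); letting c tend to sg gives
    sg <= r1^2 - r0^2.

    If phi (L(s)) misses the family, then by connectedness it lies in D(s) or
    in the annulus between L(b - s) and L(b).  The inequality above, applied
    to the inverse of phi on a disk of area < s or on an annulus of area < s,
    or to phi on D(s) when phi (D(s)) engulfs a disk of area > s, is then
    violated. *)

Require Import Defs.
From HB Require Import structures.
From mathcomp Require Import all_boot all_order all_algebra.
From mathcomp Require Import all_classical all_reals all_analysis.
From mathcomp Require Import ring lra.

Import Order.TTheory GRing.Theory Num.Theory.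
Import numFieldNormedType.Exports.

Local Open Scope classical_set_scope.
Local Open Scope ring_scope.

(** * Calculus along curves and symmetry of second derivatives *)

Lemma is_derive_comp_diff (R : realType) (V W : normedModType R) (f : V -> W)
    (c : R -> V) (t : R) (v : V) :
  is_derive t 1 c v -> differentiable f (c t) ->
  is_derive t 1 (fun u => f (c u)) ('d f (c t) v).
Proof.
move=> [dc <-] df; have dc' : differentiable c t by apply/derivable1_diffP.
have dfc : differentiable (f \o c) t by exact: differentiable_comp.
apply: DeriveDef; first exact/derivable1_diffP.
by rewrite (deriveE _ dfc) diff_comp //= deriveE.
Qed.

Lemma is_derive_pair {R : realType} {V W : normedModType R} {c1 : R -> V}
    {c2 : R -> W} {t : R} {v w} :
  is_derive t 1 c1 v -> is_derive t 1 c2 w ->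
  is_derive t 1 (fun u => (c1 u, c2 u)) (v, w).
Proof.
move=> [d1 <-] [d2 <-].
have {}d1 : differentiable c1 t by apply/derivable1_diffP.
have {}d2 : differentiable c2 t by apply/derivable1_diffP.
apply: DeriveDef; first exact/derivable1_diffP/differentiable_pair.
by rewrite deriveE ?diff_pair ?deriveE //; exact: differentiable_pair.
Qed.

Lemma is_derive_line (R : realType) (V : normedModType R) (a v : V) (t : R) :
  is_derive t 1 (fun u : R => a + u *: v) v.
Proof.
have -> : (fun u : R => a + u *: v) = cst a + *:%R^~ v by apply/funext.
have d : differentiable ( *:%R^~ v : R -> V) t by [].
apply: DeriveDef; first by apply/derivable1_diffP; exact: differentiableD.
rewrite deriveE; last exact: differentiableD.
by rewrite diffD // diff_cst diff_val /= add0r scale1r.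
Qed.

Lemma is_derive_along (R : realType) (V : normedModType R) (f : V -> R)
    (a v : V) (t : R) :
  differentiable f (a + t *: v) ->
  is_derive t 1 (fun u => f (a + u *: v)) ('d f (a + t *: v) v).
Proof. by move=> df; apply: is_derive_comp_diff df; exact: is_derive_line. Qed.

Lemma is_derive_continuous {R : realType} {V : normedModType R} {f : R -> V}
    {t : R} {v} :
  is_derive t 1 f v -> {for t, continuous f}.
Proof. by move=> [/derivable1_diffP d _]; exact: differentiable_continuous. Qed.

Lemma is_derive_within_continuous {R : realType} {f df : R -> R} {a b : R} :
  (forall x, a <= x <= b -> is_derive x 1 f (df x)) ->
  {within `[a, b], continuous f}.
Proof.
move=> d; apply: derivable_within_continuous => x; rewrite in_itv /= => /d.
by case.
Qed.

Lemma mean_value {R : realType} {f df : R -> R} {a b : R} : a < b ->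
  (forall x, a <= x <= b -> is_derive x 1 f (df x)) ->
  exists2 c, a < c < b & f b - f a = df c * (b - a).
Proof.
move=> ab d; have [x| |c cab E] := @MVT R f df a b ab.
- by rewrite in_itv /= => /andP[ax xb]; apply: d; rewrite !ltW.
- exact: is_derive_within_continuous d.
by exists c => //; move: cab; rewrite in_itv.
Qed.

Lemma is_derive_le (R : realType) (f df : R -> R) (a b : R) : a <= b ->
  (forall x, a <= x <= b -> is_derive x 1 f (df x)) ->
  (forall x, a <= x <= b -> 0 <= df x) -> f a <= f b.
Proof.
rewrite le_eqVlt => /predU1P[->//|ab] d pos.
have [c /andP[ac cb] E] := mean_value ab d.
by rewrite -subr_ge0 E mulr_ge0 ?pos ?subr_ge0 ?ltW.
Qed.

Lemma is_derive_eq0 (R : realType) (f : R -> R) (a b : R) : a <= b ->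
  (forall x, a <= x <= b -> is_derive x 1 f 0) -> f a = f b.
Proof.
rewrite le_eqVlt => /predU1P[->//|ab] d.
have [c _ ] := mean_value ab d.
by rewrite mul0r => /eqP; rewrite subr_eq0 => /eqP.
Qed.

Section Schwarz.
Variables (R : realType) (V : normedModType R) (f : V -> R).
Hypothesis df : forall x, differentiable f x.

(** The mean value theorem is applied twice: along [u] to the difference of [f] on two parallel
    segments offset by [h *: v], then along [v] to the derivative so obtained. *)
Lemma second_difference (z u v : V) (h : R) : 0 < h ->
  (forall x, differentiable (fun y => 'd f y u) x) ->
  exists x y, [/\ 0 < x < h, 0 < y < h &
    f (z + h *: u + h *: v) - f (z + h *: u) - f (z + h *: v) + f z =
    'd (fun y => 'd f y u) (z + x *: u + y *: v) v * h ^+ 2].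
Proof.
move=> h0 ddf.
pose g s := f (z + h *: v + s *: u) - f (z + s *: u).
have dg s : 0 <= s <= h -> is_derive s 1 g
    ('d f (z + h *: v + s *: u) u - 'd f (z + s *: u) u).
  by move=> _; apply: is_deriveB; exact: is_derive_along.
have [x x0h E] := mean_value h0 dg.
have dk s : 0 <= s <= h -> is_derive s 1
    (fun s => 'd f (z + x *: u + s *: v) u)
    ('d (fun y => 'd f y u) (z + x *: u + s *: v) v).
  by move=> _; exact: (is_derive_along _ _ (fun y => 'd f y u)).
have [y y0h E'] := mean_value h0 dk.
exists x, y; split=> //; rewrite expr2 mulrA.
move: E' E; rewrite !subr0 scale0r addr0 => <- /=.
rewrite /g !scale0r !addr0 (addrAC z (h *: v)) (addrAC z (h *: v) (x *: u)).
by move=> <-; lra.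
Qed.

End Schwarz.

(** The second difference over the parallelogram spanned by [h *: u] and [h *: v] is symmetric in
    [u] and [v]. So the two mixed derivatives agree at a pair of points as close to [z] as desired,
    and continuity carries the equality to [z]. *)
Lemma schwarz (R : realType) (V : normedModType R) (f : V -> R) (z u v : V) :
  (forall x, differentiable f x) ->
  (forall w x, differentiable (fun y => 'd f y w) x) ->
  (forall w w', continuous (fun x => 'd (fun y => 'd f y w) x w')) ->
  'd (fun y => 'd f y u) z v = 'd (fun y => 'd f y v) z u.
Proof.
move=> df ddf cddf; apply/eqP; rewrite -subr_eq0 -normr_eq0 eq_le normr_ge0 andbT.
apply/ler_addgt0Pl => e e0; rewrite addr0.
pose F x y : R := 'd (fun y => 'd f y u) (z + x *: u + y *: v) v.
pose G x y : R := 'd (fun y => 'd f y v) (z + x *: u + y *: v) u.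
have cF w w' : exists2 d, 0 < d & forall x y, 0 < x < d -> 0 < y < d ->
    `|'d (fun y => 'd f y w) z w' -
      'd (fun y => 'd f y w) (z + x *: u + y *: v) w'| < e / 2.
  have e2 : 0 < e / 2 by rewrite divr_gt0.
  have /cvgrPdist_lt/(_ _ e2)/nbhs_ballP[d /= d0 D] := cddf w w' z.
  pose N : R := 1 + `|u| + `|v|.
  have N0 : 0 < N by rewrite /N -addrA ltr_pwDl // addr_ge0.
  (* For [x] and [y] below [d / N] the displacement [x *: u + y *: v] has norm below [d]; the
     summand 1 keeps [N] positive when both vectors vanish. *)
  exists (d / N); first by rewrite divr_gt0.
  move=> x y /andP[x0 xd] /andP[y0 yd]; apply: D.
  rewrite -ball_normE /= -addrA opprD addrA subrr sub0r normrN.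
  apply: le_lt_trans (ler_normD _ _) _; rewrite !normrZ (gtr0_norm x0) (gtr0_norm y0).
  apply: (@le_lt_trans _ _ (d / N * (`|u| + `|v|))).
    by rewrite mulrDr lerD // ler_wpM2r // ltW.
  rewrite -mulrA gtr_pMr // mulrC ltr_pdivrMr // mul1r /N -addrA.
  by rewrite ltr_pwDl.
have [d1 d10 D1] := cF u v; have [d2 d20 D2] := cF v u.
pose h := Num.min d1 d2.
have h0 : 0 < h by rewrite lt_min d10.
have [x [y [/andP[x0 xh] /andP[y0 yh] E]]] := second_difference _ _ _ df z u v h h0 (ddf u).
have [y' [x' [/andP[y'0 y'h] /andP[x'0 x'h] E']]] :=
  second_difference _ _ _ df z v u h h0 (ddf v).
rewrite (addrAC z (y' *: v)) in E'.
have {E E'} E : 'd (fun y => 'd f y u) (z + x *: u + y *: v) v =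
    'd (fun y => 'd f y v) (z + x' *: u + y' *: v) u.
  have h2 : h ^+ 2 != 0 by rewrite expf_neq0 // gt_eqF.
  apply: (mulIf h2); rewrite -E -E' (addrAC z (h *: v)); lra.
have := D1 x y; have := D2 x' y'; rewrite -E.
rewrite x0 y0 x'0 y'0 /=.
rewrite !(lt_le_trans x'h, lt_le_trans y'h, lt_le_trans xh, lt_le_trans yh)
  ?ge_min ?lexx ?orbT //.
move=> /(_ isT isT) + /(_ isT isT); rewrite !ltr_norml ler_norml.
by move=> /andP[A B] /andP[C D]; lra.
Qed.

(** * Differentiation rules for real functions of one variable *)

Lemma is_derive_add {R : realType} {f g : R -> R} {t a b : R} :
  is_derive t 1 f a -> is_derive t 1 g b ->
  is_derive t 1 (fun x => f x + g x) (a + b).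
Proof. by move=> df dg; exact: (is_deriveD df dg). Qed.

Lemma is_derive_sub {R : realType} {f g : R -> R} {t a b : R} :
  is_derive t 1 f a -> is_derive t 1 g b ->
  is_derive t 1 (fun x => f x - g x) (a - b).
Proof. by move=> df dg; exact: (is_deriveB df dg). Qed.

Lemma is_derive_mul {R : realType} {f g : R -> R} {t a b : R} :
  is_derive t 1 f a -> is_derive t 1 g b ->
  is_derive t 1 (fun x => f x * g x) (a * g t + f t * b).
Proof.
move=> df dg; apply: is_derive_eq (is_deriveM df dg) _.
by rewrite /GRing.scale /= addrC mulrC.
Qed.

Lemma is_derive_sqr {R : realType} {f : R -> R} {t a : R} :
  is_derive t 1 f a -> is_derive t 1 (fun x => f x ^+ 2) (2 * (f t * a)).
Proof.
by move=> df; apply: is_derive_eq (is_derive_mul df df) _; ring.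
Qed.

Lemma is_derive_scale (R : realType) (k : R) (f : R -> R) (t a : R) :
  is_derive t 1 f a -> is_derive t 1 (fun x => k * f x) (k * a).
Proof. by move=> df; exact: (is_deriveZ k df). Qed.

Lemma is_derive_inv {R : realType} {f : R -> R} {t a : R} : f t != 0 ->
  is_derive t 1 f a -> is_derive t 1 (fun x => (f x)^-1) (- (a / f t ^+ 2)).
Proof.
move=> f0 df; apply: is_derive_eq (is_deriveV f0 df) _.
by rewrite /GRing.scale /= mulNr mulrC.
Qed.

(** * Gronwall estimate and Taylor bounds on boxes *)

Lemma fst_continuous (R : realType) (V W : normedModType R) :
  continuous (@fst V W).
Proof. by move=> x; exact: cvg_fst. Qed.

Lemma snd_continuous (R : realType) (V W : normedModType R) :
  continuous (@snd V W).
Proof. by move=> x; exact: cvg_snd. Qed.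

Lemma is_derive_fst {R : realType} {V W : normedModType R} {c : R -> V * W}
    {t : R} {v} : is_derive t 1 c v -> is_derive t 1 (fun u => (c u).1) v.1.
Proof.
move=> d; have := @is_derive_comp_diff R _ _ fst c t v d.
rewrite diff_lin; last exact: fst_continuous.
by apply; apply: linear_differentiable; exact: fst_continuous.
Qed.

Lemma is_derive_snd {R : realType} {V W : normedModType R} {c : R -> V * W}
    {t : R} {v} : is_derive t 1 c v -> is_derive t 1 (fun u => (c u).2) v.2.
Proof.
move=> d; have := @is_derive_comp_diff R _ _ snd c t v d.
rewrite diff_lin; last exact: snd_continuous.
by apply; apply: linear_differentiable; exact: snd_continuous.
Qed.

Section SmoothFunctions.
Variables (R : realType) (V W : normedModType R).

Lemma smooth_continuous (f : V -> W) : smooth f -> continuous f.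
Proof. by move=> /(_ 0%N). Qed.

Lemma smooth_differentiable (f : V -> W) x : smooth f -> differentiable f x.
Proof. by move=> /(_ 1%N)[]. Qed.

Lemma smooth_directional (f : V -> W) v :
  smooth f -> smooth (fun x => 'd f x v).
Proof. by move=> sf k; have [_] := sf k.+1; exact. Qed.

(** Induction on the order: a directional derivative of [l (f x)] is [l] applied to that of [f],
    hence of the same shape. *)
Lemma smooth_linear_comp (U : normedModType R) (l : {linear W -> U}) (f : V -> W) :
  continuous l -> smooth f -> smooth (fun x => l (f x)).
Proof.
move=> cl sf k; move: (sf k); elim: k f {sf} => [|k IH] f /=.
  by move=> cf x; apply: (@continuous_comp _ _ _ f l); [exact: cf|exact: cl].
move=> [df sf]; split=> [x|v].
  by apply: (differentiable_comp (df x)); exact: linear_differentiable.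
have -> : (fun x => 'd (fun y => l (f y)) x v) = (fun x => l ('d f x v)).
  apply/funext => x; have dl : differentiable l (f x) by exact: linear_differentiable.
  by rewrite (@diff_comp R _ _ _ f l x (df x) dl) /= diff_lin.
exact: IH.
Qed.

End SmoothFunctions.

(** As long as [u <= 1], the function [v t = u t * expR (- K * t)] decreases, which bounds [u] by
    [u 0 * expR K < 1]. The conclusion is thus stronger than the condition it was derived under, and
    that condition can never fail first. *)
Lemma gronwall_bootstrap (R : realType) (u du : R -> R) (K : R) : 0 <= K -> 0 <= u 0 ->
  (forall t : R, 0 <= t <= 1 -> is_derive t 1 u (du t)) ->
  (forall t : R, 0 <= t <= 1 -> u t <= 1 -> du t <= K * u t) ->
  u 0 * expR K < 1 ->
  forall t : R, 0 <= t <= 1 -> u t <= u 0 * expR K.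
Proof.
move=> K0 u0 deru ler u0K.
pose v t := u t * expR (- K * t).
have derv (t : R) : 0 <= t <= 1 ->
    is_derive t 1 v ((du t - K * u t) * expR (- K * t)).
  move=> t01; have := deru t t01 => dt.
  have dK : is_derive t 1 (fun x : R => - K * x) (- K).
    have := @is_deriveZ R _ _ (@id R) (- K) t 1 1 (is_derive_id _ _).
    by rewrite /GRing.scale /= mulr1.
  have dE : is_derive t 1 (fun x : R => expR (- K * x)) (expR (- K * t) * - K).
    exact: is_derive1_comp.
  apply: (@is_derive_eq _ _ _ _ _ _ _ _ (is_deriveM dt dE)).
  by rewrite /GRing.scale /=; lra.
have vu (t : R) : 0 <= t <= 1 -> v t <= u 0 -> u t <= u 0 * expR K.
  move=> /andP[t0 t1]; rewrite /v mulNr expRN ler_pdivrMr ?expR_gt0 // => h.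
  by apply: (le_trans h); rewrite ler_wpM2l // ler_expR ler_piMr.
have v0 : v 0 = u 0 by rewrite /v mulr0 expR0 mulr1.
have decr (a b : R) : 0 <= a -> a <= b -> b <= 1 ->
    (forall s : R, a <= s <= b -> u s <= 1) -> v b <= v a.
  move=> a0 ab b1 us.
  have inc (s : R) : a <= s <= b -> 0 <= s <= 1.
    by move=> /andP[as_ sb]; rewrite (le_trans a0 as_) (le_trans sb b1).
  rewrite -lerN2.
  apply: (@is_derive_le R (fun t => - v t)
      (fun t => - ((du t - K * u t) * expR (- K * t))) a b ab).
    by move=> s sab; exact: (is_deriveN (derv s (inc s sab))).
  move=> s sab; rewrite -mulNr mulr_ge0 ?expR_ge0 // opprB subr_ge0.
  by apply: ler; [exact: inc|exact: us].
(* The differential inequality is only known while [u <= 1]; [tau] is the last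
   time up to which the conclusion, hence [u < 1], holds. *)
pose E := [set t : R | 0 <= t <= 1 /\ forall s : R, 0 <= s <= t -> v s <= u 0].
have E0 : E 0.
  split; first by rewrite lexx ler01.
  by move=> s; rewrite -eq_le => /eqP <-; rewrite v0.
have hE : has_sup E by split; [exists 0|exists 1 => t [/andP[]]].
pose tau := sup E.
have tau0 : 0 <= tau by exact: (ub_le_sup hE.2).
have tau1 : tau <= 1 by apply: ge_sup; [exists 0|move=> t [/andP[]]].
have below (s : R) : 0 <= s < tau -> v s <= u 0.
  move=> /andP[s0 st]; have := @sup_adherent R E (tau - s).
  rewrite subr_gt0 => /(_ st hE)[t [_ Et]].
  rewrite opprB addrC subrK => stt.
  by apply: Et; rewrite s0 ltW.
have tau01 : 0 <= tau <= 1 by rewrite tau0.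
have at_tau : v tau <= u 0.
  have [->|taun0] := eqVneq tau 0; first by rewrite v0.
  have taugt0 : 0 < tau by rewrite lt_neqAle eq_sym taun0.
  apply/ler_addgt0Pr => e e0.
  have /cvgrPdist_lt/(_ _ e0)/nbhs_ballP[d /= d0 D] :=
    is_derive_continuous (derv tau tau01).
  pose m := Num.max 0 (tau - d / 2).
  have m1 : m < tau by rewrite gt_max taugt0 /= ltrBlDr ltrDl divr_gt0.
  have m2 : 0 <= m by rewrite le_max lexx.
  have m3 : tau - d / 2 <= m by rewrite le_max lexx orbT.
  have := below m; rewrite m2 m1 => /(_ isT) vm.
  have : `|v tau - v m| < e.
    apply: D; rewrite -ball_normE /= gtr0_norm ?subr_gt0 //; lra.
  by rewrite ltr_norml => /andP[_ A]; lra.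
have Etau : E tau.
  split=> // s /andP[s0]; rewrite le_eqVlt => /predU1P[->//|st].
  by apply: below; rewrite s0.
suff : tau = 1.
  by move=> t1 t /[dup] t01 /andP[t0 tle]; apply: vu => //;
     apply: Etau.2; rewrite t0 t1.
(* If [tau < 1], then [u tau < 1] and continuity keep [u <= 1] up to some [m > tau]. There [v] still
   decreases, so [m] belongs to [E], against the choice of [tau]. *)
apply/eqP; rewrite eq_le tau1 /= leNgt; apply/negP => taul1.
have u1 : u tau < 1 by apply: le_lt_trans u0K; exact: vu.
have e0 : 0 < 1 - u tau by rewrite subr_gt0.
have /cvgrPdist_lt/(_ _ e0)/nbhs_ballP[d /= d0 D] :=
  is_derive_continuous (deru tau tau01).
pose m := Num.min 1 (tau + d / 2).
have m1 : tau < m by rewrite lt_min taul1 /= ltrDl divr_gt0.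
have m2 : m <= 1 by rewrite ge_min lexx.
have m3 : m <= tau + d / 2 by rewrite ge_min lexx orbT.
have us (s : R) : tau <= s <= m -> u s <= 1.
  move=> /andP[ts sm]; have : `|u tau - u s| < 1 - u tau.
    apply: D; rewrite -ball_normE /= ler0_norm ?subr_le0 //; lra.
  by rewrite ltr_norml => /andP[A _]; lra.
have : E m.
  split; first by rewrite m2 (le_trans tau0 (ltW m1)).
  move=> s /andP[s0 sm]; have [stau|taus] := leP s tau.
    by apply: Etau.2; rewrite s0.
  apply: le_trans at_tau; apply: decr => //; first exact: ltW.
    exact: le_trans sm m2.
  by move=> r /andP[tr rs]; apply: us; rewrite tr (le_trans rs sm).
by move=> /(ub_le_sup hE.2); rewrite leNgt m1.
Qed.

Section Box.
Variable R : realType.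
Implicit Types f : R * (R * R) -> R.

Lemma box_bound f (M : R) : continuous f -> exists2 L, 0 <= L &
  forall t x y, 0 <= t <= 1 -> `|x| <= M -> `|y| <= M -> `|f (t, (x, y))| <= L.
Proof.
move=> cf.
pose B : set (R * (R * R)) := `[0, 1] `*` (`[- M, M] `*` `[- M, M]).
have cB : compact B by apply: compact_setX; [|apply: compact_setX];
  exact: segment_compact.
have /compact_bounded/pinfty_ex_gt0[L L0 HL] : compact (f @` B).
  apply: continuous_compact => //; exact: continuous_subspaceT.
exists L; first exact: ltW.
move=> t x y t01 xM yM; apply: HL; exists (t, (x, y)) => //.
by split; [|split]; rewrite /= in_itv /= -?ler_norml.
Qed.

Definition e1 : R * (R * R) := (0, (1, 0)).
Definition e2 : R * (R * R) := (0, (0, 1)).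

Lemma diff_space f a p q : differentiable f a ->
  'd f a (0, (p, q)) = p * 'd f a e1 + q * 'd f a e2.
Proof.
move=> df; have -> : (0, (p, q)) = p *: e1 + q *: e2 :> R * (R * R).
  rewrite /e1 /e2; congr (_, (_, _)) => /=.
  all: rewrite ?scaler0 /GRing.scale /= ?mulr0 ?mulr1 ?addr0 ?add0r //.
by rewrite linearD !linearZ.
Qed.

(** Time is a parameter: the spatial derivatives are continuous jointly in time and space, so that
    compactness gives bounds uniform for times in [[0, 1]]. *)
Definition C1_space f :=
  [/\ forall a, differentiable f a, continuous (fun a => 'd f a e1)
    & continuous (fun a => 'd f a e2)].

Lemma mean_value_space f t x y p q : (forall a, differentiable f a) ->
  exists2 c, 0 < c < 1 & f (t, (x + p, y + q)) - f (t, (x, y)) =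
    p * 'd f (t, (x + c * p, y + c * q)) e1 +
    q * 'd f (t, (x + c * p, y + c * q)) e2.
Proof.
move=> df.
have line s : ((t, (x, y)) : R * (R * R)) + s *: ((0, (p, q)) : R * (R * R)) =
    (t, (x + s * p, y + s * q)).
  by congr (_, (_, _)) => /=; rewrite scaler0 addr0.
have [|c c01 E] := @mean_value R (fun s => f (t, (x + s * p, y + s * q)))
   (fun s => 'd f (t, (x + s * p, y + s * q)) (0, (p, q))) 0 1 ltr01.
  move=> s _; rewrite -line; have -> : (fun s => f (t, (x + s * p, y + s * q))) =
      (fun s => f ((t, (x, y)) + s *: (0, (p, q)))).
    by apply/funext => r; rewrite line.
  exact: is_derive_along.
exists c => //; move: E; rewrite diff_space // subr0 mulr1 => <-.
by congr (f (_, (_, _)) - f (_, (_, _))); rewrite ?mul1r ?mul0r ?addr0.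
Qed.

(** Convexity of [[- M, M]]: [x + c * p] is a convex combination of [x] and [x + p]. *)
Lemma segment_box (M x p c : R) : 0 < c < 1 -> `|x| <= M -> `|x + p| <= M ->
  `|x + c * p| <= M.
Proof.
move=> /andP[c0 c1]; rewrite !ler_norml => /andP[A B] /andP[C D].
have c1' : 0 <= 1 - c by rewrite subr_ge0 ltW.
have := mulr_ge0 (ltW c0) (_ : 0 <= M - (x + p)).
have := mulr_ge0 (ltW c0) (_ : 0 <= x + p + M).
have := mulr_ge0 c1' (_ : 0 <= M - x).
have := mulr_ge0 c1' (_ : 0 <= x + M).
move=> /(_ ltac:(lra)) X1 /(_ ltac:(lra)) X2 /(_ ltac:(lra)) X3 /(_ ltac:(lra)) X4.
by apply/andP; split; lra.
Qed.

Lemma box_lipschitz f M : C1_space f -> exists2 L, 0 <= L &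
  forall t x y p q, 0 <= t <= 1 -> `|x| <= M -> `|y| <= M ->
    `|x + p| <= M -> `|y + q| <= M ->
  `|f (t, (x + p, y + q)) - f (t, (x, y))| <= L * (`|p| + `|q|).
Proof.
move=> [df c1 c2]; have [L1 L10 H1] := box_bound _ M c1.
have [L2 L20 H2] := box_bound _ M c2.
exists (L1 + L2); first exact: addr_ge0.
move=> t x y p q t01 xM yM xpM yqM.
have [c c01 ->] := mean_value_space f t x y p q df.
apply: le_trans (ler_normD _ _) _; rewrite !normrM.
have xcM := segment_box _ _ _ _ c01 xM xpM.
have ycM := segment_box _ _ _ _ c01 yM yqM.
have := H1 t _ _ t01 xcM ycM; have := H2 t _ _ t01 xcM ycM.
set A := `|_ e1|; set B := `|_ e2| => BL AL.
have := ler_wpM2l (normr_ge0 p) AL; have := ler_wpM2l (normr_ge0 q) BL.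
have := mulr_ge0 (normr_ge0 p) L20; have := mulr_ge0 (normr_ge0 q) L10.
lra.
Qed.

(** Here [A], [B] stand for the partial derivatives at the intermediate point of the mean value
    theorem and [A0], [B0] for those at the base point. Their Lipschitz bounds make the error
    quadratic in the displacement. *)
Lemma taylor_remainder (p q c A A0 B B0 L1 L2 : R) : 0 <= L1 -> 0 <= L2 ->
  0 < c < 1 -> `|A - A0| <= L1 * (`|c * p| + `|c * q|) ->
  `|B - B0| <= L2 * (`|c * p| + `|c * q|) ->
  `|p * A + q * B - (p * A0 + q * B0)| <= (L1 + L2) * (`|p| + `|q|) ^+ 2.
Proof.
move=> L10 L20 /andP[c0 c1]; rewrite !normrM (gtr0_norm c0) -mulrDr => HA HB.
have -> : p * A + q * B - (p * A0 + q * B0) = p * (A - A0) + q * (B - B0) by lra.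
apply: le_trans (ler_normD _ _) _; rewrite !normrM.
have p0 := normr_ge0 p; have q0 := normr_ge0 q.
set S := `|p| + `|q| in HA HB *.
have S0 : 0 <= S by exact: addr_ge0.
have pS : `|p| <= S by rewrite lerDl.
have qS : `|q| <= S by rewrite lerDr.
have cS : c * S <= S by rewrite ler_piMl // ltW.
have {}HA : `|A - A0| <= L1 * S by apply: le_trans HA _; rewrite ler_wpM2l.
have {}HB : `|B - B0| <= L2 * S by apply: le_trans HB _; rewrite ler_wpM2l.
have := ler_pM p0 (normr_ge0 _) pS HA; have := ler_pM q0 (normr_ge0 _) qS HB.
by move=> X Y; lra.
Qed.

Lemma box_taylor f M : C1_space f -> C1_space (fun a => 'd f a e1) ->
  C1_space (fun a => 'd f a e2) -> exists2 L, 0 <= L &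
  forall t x y p q, 0 <= t <= 1 -> `|x| <= M -> `|y| <= M ->
    `|x + p| <= M -> `|y + q| <= M ->
  `|f (t, (x + p, y + q)) - f (t, (x, y)) -
    (p * 'd f (t, (x, y)) e1 + q * 'd f (t, (x, y)) e2)|
     <= L * (`|p| + `|q|) ^+ 2.
Proof.
move=> [df _ _] C1 C2; have [L1 L10 H1] := box_lipschitz _ M C1.
have [L2 L20 H2] := box_lipschitz _ M C2.
exists (L1 + L2); first exact: addr_ge0.
move=> t x y p q t01 xM yM xpM yqM.
have [c c01 ->] := mean_value_space f t x y p q df.
have xcM := segment_box _ _ _ _ c01 xM xpM.
have ycM := segment_box _ _ _ _ c01 yM yqM.
apply: taylor_remainder c01 _ _ => //; [exact: H1|exact: H2].
Qed.

End Box.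

(** * Area distortion of a Hamiltonian flow *)

Section Flow.
Variables (R : realType) (H : R * (R * R) -> R) (Phi : R -> R * R -> R * R).
Hypotheses (sH : smooth H) (flow : hamiltonian_flow H Phi).

Local Notation e1 := (e1 R).
Local Notation e2 := (e2 R).
Let X1 a := 'd H a e2.
Let X2 a := - 'd H a e1.

Let dH a : differentiable H a.
Proof. exact: smooth_differentiable. Qed.

Lemma smooth_C1_space (f : R * (R * R) -> R) : smooth f -> C1_space R f.
Proof.
move=> sf; split=> [a||]; first exact: smooth_differentiable.
- exact/smooth_continuous/smooth_directional.
- exact/smooth_continuous/smooth_directional.
Qed.

(** Both sides are limits of the same difference quotient. This links the Hamiltonian vector field,
    defined at frozen time, to the differential of [H] on space-time. *)
Lemma derive_slice (t : R) (w v : R * R) :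
  'D_v (fun z => H (t, z)) w = 'd H (t, w) (0, v).
Proof.
transitivity ('D_((0, v) : R * (R * R)) H (t, w)); last exact: deriveE.
rewrite /derive; set f := fun h => _; set g := fun h => _.
suff -> : f = g by [].
apply/funext => h; rewrite /f /g /=.
by congr (_ *: (H (_, _) - _)) => /=; rewrite scaler0 add0r.
Qed.

Lemma flow1 (z : R * R) (t : R) : 0 <= t <= 1 ->
  is_derive t 1 (fun u => (Phi u z).1) (X1 (t, Phi t z)).
Proof.
move=> t01; have := is_derive_fst (flow.2 z t t01).
by rewrite /hamiltonian_vector_field /= derive_slice.
Qed.

Lemma flow2 (z : R * R) (t : R) : 0 <= t <= 1 ->
  is_derive t 1 (fun u => (Phi u z).2) (X2 (t, Phi t z)).
Proof.
move=> t01; have := is_derive_snd (flow.2 z t t01).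
by rewrite /hamiltonian_vector_field /= derive_slice.
Qed.

Lemma trajectory_bounded (z : R * R) : exists2 M : R, 0 < M &
  forall t : R, 0 <= t <= 1 -> `|(Phi t z).1| <= M /\ `|(Phi t z).2| <= M.
Proof.
have c1 := is_derive_within_continuous (flow1 z).
have c2 := is_derive_within_continuous (flow2 z).
have K : compact `[(0 : R), 1] := @segment_compact _ _ _.
have /compact_bounded/pinfty_ex_gt0[M1 M10 H1] := continuous_compact c1 K.
have /compact_bounded/pinfty_ex_gt0[M2 M20 H2] := continuous_compact c2 K.
exists (M1 + M2); first exact: addr_gt0.
move=> t t01.
have := H1 (Phi t z).1; have := H2 (Phi t z).2.
move=> /(_ (ex_intro2 _ _ t t01 erefl)) A2 /(_ (ex_intro2 _ _ t t01 erefl)) A1.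
by split; [apply: le_trans A1 _; rewrite lerDl|apply: le_trans A2 _; rewrite lerDr];
  exact: ltW.
Qed.

Section OneTrajectory.
Variable z : R * R.

Definition gap1 (w : R * R) t := (Phi t w).1 - (Phi t z).1.
Definition gap2 (w : R * R) t := (Phi t w).2 - (Phi t z).2.
Definition gap_sqr (w : R * R) t := gap1 w t ^+ 2 + gap2 w t ^+ 2.

Lemma norm_le1_of_sqr (p q : R) : p ^+ 2 + q ^+ 2 <= 1 -> `|p| <= 1.
Proof.
move=> h; rewrite -(@ler_pXn2r _ 2) ?nnegrE // real_normK ?num_real // expr1n.
by apply: le_trans h; rewrite lerDl sqr_ge0.
Qed.

Lemma sum_sqr_bound (p q : R) : (`|p| + `|q|) ^+ 2 <= 2 * (p ^+ 2 + q ^+ 2).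
Proof.
rewrite -(real_normK (num_real p)) -(real_normK (num_real q)).
have := sqr_ge0 (`|p| - `|q|); lra.
Qed.

Lemma gap1_derive w (t : R) : 0 <= t <= 1 -> is_derive t 1 (gap1 w)
  (X1 (t, Phi t w) - X1 (t, Phi t z)).
Proof. by move=> t01; exact: (is_deriveB (flow1 w t t01) (flow1 z t t01)). Qed.

Lemma gap2_derive w (t : R) : 0 <= t <= 1 -> is_derive t 1 (gap2 w)
  (X2 (t, Phi t w) - X2 (t, Phi t z)).
Proof. by move=> t01; exact: (is_deriveB (flow2 w t t01) (flow2 z t t01)). Qed.

Lemma gap_pair w t : Phi t w = ((Phi t z).1 + gap1 w t, (Phi t z).2 + gap2 w t).
Proof. by rewrite /gap1 /gap2 !subrKC; case: (Phi t w). Qed.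

(** Nearby trajectories separate by at most a constant factor. The field is Lipschitz on the box of
    half-width [M + 1], and the bootstrap form of the Gronwall estimate keeps the second trajectory
    within distance 1 of that of [z], hence in this box. *)
Lemma gap_bound : exists2 C : R, 0 < C & forall w, gap_sqr w 0 * C < 1 ->
  forall t : R, 0 <= t <= 1 -> gap_sqr w t <= gap_sqr w 0 * C.
Proof.
have [M M0 HM] := trajectory_bounded z.
have sX1 : smooth X1 by exact: smooth_directional.
have sX2' : smooth (fun a => 'd H a e1) by exact: smooth_directional.
have [L1 L10 H1] := box_lipschitz _ _ (M + 1) (smooth_C1_space _ sX1).
have [L2 L20 H2] := box_lipschitz _ _ (M + 1) (smooth_C1_space _ sX2').
(* The derivative of [gap_sqr] is at most [2 * (L1 + L2)] times the square of |gap1| + |gap2|, and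
   [sum_sqr_bound] contributes another factor 2. *)
pose K := 4 * (L1 + L2).
have K0 : 0 <= K by rewrite mulr_ge0 // addr_ge0.
exists (expR K); first exact: expR_gt0.
move=> w wK; apply: (@gronwall_bootstrap R (gap_sqr w)
  (fun t => 2 * (gap1 w t * (X1 (t, Phi t w) - X1 (t, Phi t z)) +
                 gap2 w t * (X2 (t, Phi t w) - X2 (t, Phi t z))))) => //.
- by rewrite /gap_sqr addr_ge0 ?sqr_ge0.
- move=> t t01.
  have d1 := gap1_derive w t t01; have d2 := gap2_derive w t t01.
  apply: is_derive_eq (is_derive_add (is_derive_sqr d1)
    (is_derive_sqr d2)) _.
  by rewrite -mulrDr.
move=> t t01; rewrite /gap_sqr => u1.
have [zM1 zM2] := HM t t01.
have p1 := norm_le1_of_sqr _ _ u1; have q1 : `|gap2 w t| <= 1.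
  by apply: (norm_le1_of_sqr _ (gap1 w t)); rewrite addrC.
have M1 (x p : R) : `|x| <= M -> `|p| <= 1 -> `|x + p| <= M + 1.
  by move=> xM pM; apply: le_trans (ler_normD _ _) _; rewrite lerD.
have M2 (x : R) : `|x| <= M -> `|x| <= M + 1.
  by move=> xM; apply: le_trans xM _; rewrite lerDl.
have := H1 t _ _ _ _ t01 (M2 _ zM1) (M2 _ zM2) (M1 _ _ zM1 p1) (M1 _ _ zM2 q1).
have := H2 t _ _ _ _ t01 (M2 _ zM1) (M2 _ zM2) (M1 _ _ zM1 p1) (M1 _ _ zM2 q1).
rewrite -gap_pair -surjective_pairing.
have -> : `|'d H (t, Phi t w) e1 - 'd H (t, Phi t z) e1| =
  `|X2 (t, Phi t w) - X2 (t, Phi t z)| by rewrite /X2 -opprD normrN.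
set D1 := X1 _ - X1 _; set D2 := X2 _ - X2 _.
move: (gap1 w t) (gap2 w t) D1 D2 => p q D1 D2 B2 B1.
set S := `|p| + `|q| in B1 B2.
have S0 : 0 <= S by rewrite addr_ge0.
have pS : `|p| <= S by rewrite lerDl.
have qS : `|q| <= S by rewrite lerDr.
have := ler_pM (normr_ge0 p) (normr_ge0 D1) pS B1.
have := ler_pM (normr_ge0 q) (normr_ge0 D2) qS B2.
rewrite -!normrM => Y2 Y1.
have Z1 := le_trans (ler_norm _) Y1; have Z2 := le_trans (ler_norm _) Y2.
have := ler_wpM2l (addr_ge0 L10 L20) (sum_sqr_bound p q).
rewrite -/S /K; lra.
Qed.

(** The determinant of the two gap vectors starts at [e ^+ 2]. Under the linearised field its
    derivative is the trace times itself, that is 0; what remains are Taylor remainders of order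
    [e ^+ 2], each multiplied by a gap of order [e]. *)
Lemma det_bound : exists C : R, exists2 d : R, 0 < d & forall e, 0 < e < d ->
  `|gap1 (z + (e, 0)) 1 * gap2 (z + (0, e)) 1 -
    gap2 (z + (e, 0)) 1 * gap1 (z + (0, e)) 1 - e ^+ 2| <= C * e ^+ 3.
Proof.
have [M M0 HM] := trajectory_bounded z.
have sX1 : smooth X1 by exact: smooth_directional.
have sX2' : smooth (fun a => 'd H a e1) by exact: smooth_directional.
have [L1 L10 H1] := box_taylor _ _ (M + 1) (smooth_C1_space _ sX1)
  (smooth_C1_space _ (smooth_directional _ _ _ _ e1 sX1))
  (smooth_C1_space _ (smooth_directional _ _ _ _ e2 sX1)).
have [L2 L20 H2] := box_taylor _ _ (M + 1) (smooth_C1_space _ sX2')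
  (smooth_C1_space _ (smooth_directional _ _ _ _ e1 sX2'))
  (smooth_C1_space _ (smooth_directional _ _ _ _ e2 sX2')).
have [C C0 HC] := gap_bound.
(* Since [k ^+ 2 >= 2 * C], a gap vector of initial length [e] satisfies |gap1| + |gap2| <= [k * e]
   at all times in [[0, 1]]. *)
pose k := 1 + 2 * C.
have k0 : 0 < k by rewrite /k ltr_pwDl // mulr_ge0 // ltW.
(* Four products of a remainder and a gap occur in the derivative of the determinant, two with
   constant [L1] and two with [L2], each at most that constant times the cube of [k * e]. *)
pose B := 2 * (L1 + L2) * k ^+ 3.
pose d := Num.min 1 k^-1.
have d0 : 0 < d by rewrite lt_min ltr01 invr_gt0.
exists B, d => // e /andP[e0 ed].
have ek : e * k < 1.
  by rewrite -ltr_pdivlMr // div1r; apply: lt_le_trans ed _; rewrite ge_min lexx orbT.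
have e1' : e < 1 by apply: lt_le_trans ed _; rewrite ge_min lexx.
set w := z + (e, 0); set w' := z + (0, e).
have gw : gap_sqr w 0 = e ^+ 2.
  rewrite /gap_sqr /gap1 /gap2 !flow.1 /w /=.
  by rewrite addrAC subrr add0r addr0 subrr expr0n addr0.
have gw' : gap_sqr w' 0 = e ^+ 2.
  rewrite /gap_sqr /gap1 /gap2 !flow.1 /w' /=.
  by rewrite addr0 subrr (addrAC z.2) subrr add0r expr0n add0r.
have small : 2 * (e ^+ 2 * C) < 1.
  have := mulr_gt0 e0 C0; rewrite /k in ek.
  have : e ^+ 2 * C <= e * C by rewrite ler_pM2r // expr2 ler_piMl // ltW.
  lra.
have small' : e ^+ 2 * C < 1.
  have : 0 <= e ^+ 2 * C by rewrite mulr_ge0 ?sqr_ge0 // ltW.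
  lra.
have bnd v (t : R) : gap_sqr v 0 = e ^+ 2 -> 0 <= t <= 1 ->
    gap_sqr v t <= 1 /\ `|gap1 v t| + `|gap2 v t| <= k * e.
  move=> gv t01; have := HC v; rewrite gv => /(_ small' t t01) h.
  split; first by apply: le_trans h (ltW _).
  have ke0 : 0 <= k * e by rewrite mulr_ge0 // ltW.
  have n0 : 0 <= `|gap1 v t| + `|gap2 v t| by exact: addr_ge0.
  rewrite -(@ler_pXn2r _ 2) ?nnegrE //.
  apply: le_trans (sum_sqr_bound _ _) _; rewrite -/(gap_sqr v t) exprMn.
  have := sqr_ge0 C; have := mulr_ge0 (sqr_ge0 C) (sqr_ge0 e).
  have := sqr_ge0 e; have := mulr_ge0 (ltW C0) (sqr_ge0 e).
  by rewrite /k; lra.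
pose D t := gap1 w t * gap2 w' t - gap2 w t * gap1 w' t.
have D0 : D 0 = e ^+ 2.
  rewrite /D /gap1 /gap2 !flow.1 /w /w' /=.
  by ring.
pose V1 v t := X1 (t, Phi t v) - X1 (t, Phi t z).
pose V2 v t := X2 (t, Phi t v) - X2 (t, Phi t z).
have derD (t : R) : 0 <= t <= 1 -> is_derive t 1 D
    (V1 w t * gap2 w' t + gap1 w t * V2 w' t -
     (V2 w t * gap1 w' t + gap2 w t * V1 w' t)).
  move=> t01.
  have a1 := gap1_derive w t t01; have a2 := gap2_derive w t t01.
  have b1 := gap1_derive w' t t01; have b2 := gap2_derive w' t t01.
  exact: (is_derive_sub (is_derive_mul a1 b2)
    (is_derive_mul a2 b1)).
have -> : gap1 w 1 * gap2 w' 1 - gap2 w 1 * gap1 w' 1 - e ^+ 2 = D 1 - D 0.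
  by rewrite D0.
have [c /andP[c0 c1] ->] := mean_value ltr01 derD.
have t01 : 0 <= c <= 1 by rewrite !ltW.
rewrite subr0 mulr1.
have [zM1 zM2] := HM c t01.
have M1 (x p : R) : `|x| <= M -> `|p| <= 1 -> `|x + p| <= M + 1.
  by move=> xM pM; apply: le_trans (ler_normD _ _) _; rewrite lerD.
have M2 (x : R) : `|x| <= M -> `|x| <= M + 1.
  by move=> xM; apply: le_trans xM _; rewrite lerDl.
(* The linearised field is trace free. *)
have tr : 'd X1 (c, Phi c z) e1 = 'd (fun a => 'd H a e1) (c, Phi c z) e2.
  apply: schwarz; first exact: dH.
    by move=> v x; exact/smooth_differentiable/smooth_directional.
  by move=> v v'; exact/smooth_continuous/smooth_directional/smooth_directional.
have neg (x y r : R) : - (- x - - y + r) = x - y - r by ring.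
(* The linearised field has the matrix with rows [(a, b)] and [(- g, - a)]. The same three numbers
   serve both gap vectors. *)
have [a [b [g T]]] : exists a b g : R, forall v, gap_sqr v 0 = e ^+ 2 ->
    [/\ `|gap1 v c| + `|gap2 v c| <= k * e,
     `|V1 v c - (gap1 v c * a + gap2 v c * b)|
       <= L1 * (`|gap1 v c| + `|gap2 v c|) ^+ 2 &
     `|V2 v c + (gap1 v c * g + gap2 v c * a)|
       <= L2 * (`|gap1 v c| + `|gap2 v c|) ^+ 2].
  exists ('d X1 (c, Phi c z) e1), ('d X1 (c, Phi c z) e2).
  exists ('d (fun a => 'd H a e1) (c, Phi c z) e1) => v gv.
  have [u1 bv] := bnd v c gv t01.
  have p1 := norm_le1_of_sqr _ _ u1; have q1 : `|gap2 v c| <= 1.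
    by apply: (norm_le1_of_sqr _ (gap1 v c)); rewrite addrC.
  have := H1 c _ _ _ _ t01 (M2 _ zM1) (M2 _ zM2) (M1 _ _ zM1 p1) (M1 _ _ zM2 q1).
  have := H2 c _ _ _ _ t01 (M2 _ zM1) (M2 _ zM2) (M1 _ _ zM1 p1) (M1 _ _ zM2 q1).
  rewrite -gap_pair -surjective_pairing => B2 B1.
  split; [exact: bv|exact: B1|].
  rewrite -normrN /V2 /X2 neg; apply: le_trans B2.
  rewrite le_eqVlt; apply/predU1P; left; congr (`|_ - (_ + _ * _)|).
  exact: tr.
have [] := T w gw; have [] := T w' gw'.
move: (V1 w c) (V2 w c) (V1 w' c) (V2 w' c) (gap1 w c) (gap2 w c) (gap1 w' c) (gap2 w' c).
move=> u1 u2 v1 v2 p1 p2 q1 q2.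
set S := `|p1| + _; set Q := `|q1| + _.
set r1 := v1 - _; set r2 := v2 + _ => qb B3 B4.
set s1 := u1 - _; set s2 := u2 + _ => pb B1 B2.
(* The linear parts cancel because the matrix has trace 0, so each velocity may be replaced by its
   Taylor remainder. *)
have -> : u1 * q2 + p1 * v2 - (u2 * q1 + p2 * v1) =
   s1 * q2 + p1 * r2 - (s2 * q1 + p2 * r1) by rewrite /s1 /s2 /r1 /r2; ring.
have ke0 : 0 <= k * e by rewrite mulr_ge0 // ltW.
have sq (L x : R) : 0 <= L -> 0 <= x -> x <= k * e -> L * x ^+ 2 <= L * (k * e) ^+ 2.
  by move=> L0 x0 xke; rewrite ler_wpM2l // ler_pXn2r ?nnegrE.
have S0 : 0 <= S by rewrite addr_ge0.
have Q0 : 0 <= Q by rewrite addr_ge0.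
have {}B1 := le_trans B1 (sq _ _ L10 S0 pb).
have {}B2 := le_trans B2 (sq _ _ L20 S0 pb).
have {}B3 := le_trans B3 (sq _ _ L10 Q0 qb).
have {}B4 := le_trans B4 (sq _ _ L20 Q0 qb).
have p1b : `|p1| <= k * e by apply: le_trans pb; rewrite lerDl.
have p2b : `|p2| <= k * e by apply: le_trans pb; rewrite lerDr.
have q1b : `|q1| <= k * e by apply: le_trans qb; rewrite lerDl.
have q2b : `|q2| <= k * e by apply: le_trans qb; rewrite lerDr.
have Y1 := ler_pM (normr_ge0 _) (normr_ge0 _) B1 q2b.
have Y2 := ler_pM (normr_ge0 _) (normr_ge0 _) p1b B4.
have Y3 := ler_pM (normr_ge0 _) (normr_ge0 _) B2 q1b.
have Y4 := ler_pM (normr_ge0 _) (normr_ge0 _) p2b B3.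
apply: le_trans (ler_normB _ _) _.
apply: le_trans (lerD (ler_normD _ _) (ler_normD _ _)) _.
rewrite !normrM; apply: le_trans (lerD (lerD Y1 Y2) (lerD Y3 Y4)) _.
by rewrite le_eqVlt; apply/predU1P; left; rewrite /B; ring.
Qed.

End OneTrajectory.
End Flow.

(** * Plane calculus and Jacobians *)

Lemma is_derive_quotient (R : realType) (f : R -> R) (a : R) :
  is_derive (0 : R) 1 f a -> (f e - f 0) / e @[e --> (0 : R)^'] --> a.
Proof.
move=> [d <-]; move: d; rewrite /derivable /derive => d.
suff -> : (fun e => (f e - f 0) / e) =
  (fun h => h^-1 *: ((f \o shift 0) (h *: (1 : R)) - f 0)) by [].
by apply/funext => e; rewrite /GRing.scale /= mulr1 addr0 mulrC.
Qed.

Section Plane.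
Variable R : realType.
Implicit Types (f g : R * R -> R) (z : R * R).

Definition dx f z := 'd f z (1, 0).
Definition dy f z := 'd f z (0, 1).

Lemma diff_plane f z p q : differentiable f z ->
  'd f z (p, q) = p * dx f z + q * dy f z.
Proof.
move=> df; have -> : (p, q) = p *: (1, 0) + q *: (0, 1) :> R * R.
  congr (_, _) => /=; rewrite ?scaler0 ?addr0 ?add0r;
    by rewrite /GRing.scale /= ?mulr1.
by rewrite linearD !linearZ.
Qed.

Definition C1 f :=
  [/\ forall z, differentiable f z, continuous (dx f) & continuous (dy f)].

Lemma C1_continuous f : C1 f -> continuous f.
Proof. by move=> [df _ _] z; exact: differentiable_continuous. Qed.

Lemma smooth_C1 f : smooth f -> C1 f.
Proof.
move=> sf; split=> [z||]; first exact: smooth_differentiable.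
- exact/smooth_continuous/smooth_directional.
- exact/smooth_continuous/smooth_directional.
Qed.

Lemma smooth_dx f : smooth f -> smooth (dx f).
Proof. exact: smooth_directional. Qed.

Lemma smooth_dy f : smooth f -> smooth (dy f).
Proof. exact: smooth_directional. Qed.

Lemma dxdy f z : smooth f -> dy (dx f) z = dx (dy f) z.
Proof.
move=> sf; apply: schwarz => [x|w x|w w'].
- exact: smooth_differentiable.
- exact/smooth_differentiable/smooth_directional.
- exact/smooth_continuous/smooth_directional/smooth_directional.
Qed.

Lemma is_derive_plane f (c1 c2 : R -> R) (t p q : R) :
  differentiable f (c1 t, c2 t) -> is_derive t 1 c1 p -> is_derive t 1 c2 q ->
  is_derive t 1 (fun u => f (c1 u, c2 u))
    (p * dx f (c1 t, c2 t) + q * dy f (c1 t, c2 t)).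
Proof.
move=> df d1 d2; rewrite -diff_plane //.
exact: (@is_derive_comp_diff R _ _ f (fun u => (c1 u, c2 u)) t (p, q)
  (is_derive_pair d1 d2) df).
Qed.

Lemma is_derive_dx f (x y : R) : differentiable f (x, y) ->
  is_derive x 1 (fun u => f (u, y)) (dx f (x, y)).
Proof.
move=> df; have := is_derive_plane f id (cst y) x 1 0 df
  (is_derive_id _ _) (is_derive_cst _ _ _).
by rewrite mul1r mul0r addr0.
Qed.

Lemma is_derive_dy f (x y : R) : differentiable f (x, y) ->
  is_derive y 1 (fun u => f (x, u)) (dy f (x, y)).
Proof.
move=> df; have := is_derive_plane f (cst x) id y 0 1 df
  (is_derive_cst _ _ _) (is_derive_id _ _).
by rewrite mul1r mul0r add0r.
Qed.

Lemma dx_eq f z d : differentiable f z ->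
  is_derive z.1 1 (fun u => f (u, z.2)) d -> dx f z = d.
Proof.
case: z => x y /= /is_derive_dx d1 d2.
by rewrite -(@derive_val _ _ _ _ _ _ _ d1) (@derive_val _ _ _ _ _ _ _ d2).
Qed.

Lemma dy_eq f z d : differentiable f z ->
  is_derive z.2 1 (fun u => f (z.1, u)) d -> dy f z = d.
Proof.
case: z => x y /= /is_derive_dy d1 d2.
by rewrite -(@derive_val _ _ _ _ _ _ _ d1) (@derive_val _ _ _ _ _ _ _ d2).
Qed.

Lemma dxM f g z : differentiable f z -> differentiable g z ->
  dx (fun z => f z * g z) z = dx f z * g z + f z * dx g z.
Proof.
case: z => x y df dg; apply: dx_eq; first exact: differentiableM.
by apply: is_derive_mul; exact: is_derive_dx.
Qed.

Lemma dyM f g z : differentiable f z -> differentiable g z ->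
  dy (fun z => f z * g z) z = dy f z * g z + f z * dy g z.
Proof.
case: z => x y df dg; apply: dy_eq; first exact: differentiableM.
by apply: is_derive_mul; exact: is_derive_dy.
Qed.

Lemma dxD f g z : differentiable f z -> differentiable g z ->
  dx (fun z => f z + g z) z = dx f z + dx g z.
Proof.
case: z => x y df dg; apply: dx_eq; first exact: differentiableD.
by apply: is_derive_add; exact: is_derive_dx.
Qed.

Lemma dyD f g z : differentiable f z -> differentiable g z ->
  dy (fun z => f z + g z) z = dy f z + dy g z.
Proof.
case: z => x y df dg; apply: dy_eq; first exact: differentiableD.
by apply: is_derive_add; exact: is_derive_dy.
Qed.

Lemma dxB f g z : differentiable f z -> differentiable g z ->
  dx (fun z => f z - g z) z = dx f z - dx g z.
Proof.
case: z => x y df dg; apply: dx_eq; first exact: differentiableB.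
by apply: is_derive_sub; exact: is_derive_dx.
Qed.

Lemma dyB f g z : differentiable f z -> differentiable g z ->
  dy (fun z => f z - g z) z = dy f z - dy g z.
Proof.
case: z => x y df dg; apply: dy_eq; first exact: differentiableB.
by apply: is_derive_sub; exact: is_derive_dy.
Qed.

Lemma C1M f g : C1 f -> C1 g -> C1 (fun z => f z * g z).
Proof.
move=> cf cg; have cf0 := C1_continuous _ cf; have cg0 := C1_continuous _ cg.
case: cf cg => [df f1 f2] [dg g1 g2]; split=> [z||].
- exact: differentiableM.
- rewrite (_ : dx _ = fun z => dx f z * g z + f z * dx g z).
    by move=> z; apply: cvgD; apply: cvgM; [exact: f1|exact: cg0|exact: cf0|exact: g1].
  by apply/funext => z; rewrite dxM.
- rewrite (_ : dy _ = fun z => dy f z * g z + f z * dy g z).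
    by move=> z; apply: cvgD; apply: cvgM; [exact: f2|exact: cg0|exact: cf0|exact: g2].
  by apply/funext => z; rewrite dyM.
Qed.

Lemma C1D f g : C1 f -> C1 g -> C1 (fun z => f z + g z).
Proof.
move=> [df f1 f2] [dg g1 g2]; split=> [z||].
- exact: differentiableD.
- rewrite (_ : dx _ = fun z => dx f z + dx g z).
    by move=> z; apply: cvgD; [exact: f1|exact: g1].
  by apply/funext => z; rewrite dxD.
- rewrite (_ : dy _ = fun z => dy f z + dy g z).
    by move=> z; apply: cvgD; [exact: f2|exact: g2].
  by apply/funext => z; rewrite dyD.
Qed.

Lemma C1B f g : C1 f -> C1 g -> C1 (fun z => f z - g z).
Proof.
move=> [df f1 f2] [dg g1 g2]; split=> [z||].
- exact: differentiableB.
- rewrite (_ : dx _ = fun z => dx f z - dx g z).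
    by move=> z; apply: cvgB; [exact: f1|exact: g1].
  by apply/funext => z; rewrite dxB.
- rewrite (_ : dy _ = fun z => dy f z - dy g z).
    by move=> z; apply: cvgB; [exact: f2|exact: g2].
  by apply/funext => z; rewrite dyB.
Qed.

Section Comp.
Variables (G G' : R -> R) (f : R * R -> R).
Hypotheses (dG : forall z, is_derive (f z) 1 G (G' (f z))) (cG : continuous G').
Hypothesis cf : C1 f.

Lemma differentiable_compR z : differentiable (fun z => G (f z)) z.
Proof.
have [df _ _] := cf; have [/derivable1_diffP dGz _] := dG z.
exact: (differentiable_comp (df z) dGz).
Qed.

Lemma dx_comp z : dx (fun z => G (f z)) z = dx f z * G' (f z).
Proof.
have [df _ _] := cf; apply: dx_eq; first exact: differentiable_compR.
case: z => x y /=; rewrite mulrC.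
by apply: (@is_derive1_comp _ G (fun u => f (u, y))); exact: is_derive_dx.
Qed.

Lemma dy_comp z : dy (fun z => G (f z)) z = dy f z * G' (f z).
Proof.
have [df _ _] := cf; apply: dy_eq; first exact: differentiable_compR.
case: z => x y /=; rewrite mulrC.
by apply: (@is_derive1_comp _ G (fun u => f (x, u))); exact: is_derive_dy.
Qed.

Lemma C1_comp : C1 (fun z => G (f z)).
Proof.
have cf0 := C1_continuous _ cf; have [_ f1 f2] := cf.
have cGf : continuous (fun z => G' (f z)).
  by move=> z; apply: (@continuous_comp _ _ _ f G'); [exact: cf0|exact: cG].
split; first exact: differentiable_compR.
- rewrite (_ : dx _ = fun z => dx f z * G' (f z)).
    by move=> z; apply: cvgM; [exact: f1|exact: cGf].
  by apply/funext => z; rewrite dx_comp.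
- rewrite (_ : dy _ = fun z => dy f z * G' (f z)).
    by move=> z; apply: cvgM; [exact: f2|exact: cGf].
  by apply/funext => z; rewrite dy_comp.
Qed.

End Comp.

Definition jacobian f g z := dx f z * dy g z - dx g z * dy f z.

Lemma smooth_fst (phi : R * R -> R * R) : smooth phi -> smooth (fun z => (phi z).1).
Proof. by apply: smooth_linear_comp; exact: fst_continuous. Qed.

Lemma smooth_snd (phi : R * R -> R * R) : smooth phi -> smooth (fun z => (phi z).2).
Proof. by apply: smooth_linear_comp; exact: snd_continuous. Qed.

(** The determinant of the difference quotients of step [e] tends to the Jacobian, while
    [det_bound], divided by [e ^+ 2], places it within [C * e] of 1. *)
Lemma hamiltonian_jacobian (phi : R * R -> R * R) z :
  hamiltonian_diffeomorphism phi ->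
  jacobian (fun z => (phi z).1) (fun z => (phi z).2) z = 1.
Proof.
move=> [[sphi _] [H [Phi [sH flow E]]]].
have [C [d d0 HC]] := det_bound _ _ _ sH flow z.
have := smooth_fst _ sphi; have := smooth_snd _ sphi.
set f := fun z => (phi z).1; set g := fun z => (phi z).2 => sg sf.
case: z HC => x y HC.
have shift1 (h : R * R -> R) : smooth h -> (h (x + e, y) - h (x, y)) / e @[e --> (0 : R)^'] -->
    dx h (x, y).
  move=> sh; have dh : is_derive (0 : R) 1 (fun e => h (x + e, y)) (dx h (x, y)).
    have d1 : is_derive (0 : R) 1 (fun e => x + e) 1.
      have := @is_derive_add R _ _ (0 : R) _ _ (is_derive_cst x _ _) (is_derive_id _ _).
      by rewrite add0r.
    have := is_derive_plane h (fun e => x + e) (cst y) 0 1 0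
       (smooth_differentiable _ _ _ _ _ sh) d1 (is_derive_cst _ _ _).
    by rewrite mul1r mul0r !addr0.
  by have := is_derive_quotient _ _ _ dh; rewrite addr0.
have shift2 (h : R * R -> R) : smooth h -> (h (x, y + e) - h (x, y)) / e @[e --> (0 : R)^'] -->
    dy h (x, y).
  move=> sh; have dh : is_derive (0 : R) 1 (fun e => h (x, y + e)) (dy h (x, y)).
    have d1 : is_derive (0 : R) 1 (fun e => y + e) 1.
      have := @is_derive_add R _ _ (0 : R) _ _ (is_derive_cst y _ _) (is_derive_id _ _).
      by rewrite add0r.
    have := is_derive_plane h (cst x) (fun e => y + e) 0 0 1
       (smooth_differentiable _ _ _ _ _ sh) (is_derive_cst _ _ _) d1.
    by rewrite mul1r mul0r add0r addr0.
  by have := is_derive_quotient _ _ _ dh; rewrite addr0.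
have cv : (f (x + e, y) - f (x, y)) / e * ((g (x, y + e) - g (x, y)) / e) -
    (g (x + e, y) - g (x, y)) / e * ((f (x, y + e) - f (x, y)) / e)
    @[e --> (0 : R)^'] --> jacobian f g (x, y).
  exact: cvgB (cvgM (shift1 f sf) (shift2 g sg)) (cvgM (shift1 g sg) (shift2 f sf)).
apply/eqP; rewrite -subr_eq0 -normr_eq0 eq_le normr_ge0 andbT.
apply/ler_addgt0Pl => eps eps0; rewrite addr0.
have eps2 : 0 < eps / 2 by rewrite divr_gt0.
have /cvgrPdist_lt/(_ _ eps2)/nbhs_ballP[r /= r0 D] := cv.
pose K := 2 * (`|C| + 1).
have K0 : 0 < K by rewrite mulr_gt0 // ltr_wpDl.
(* The three bounds make [det_bound] applicable, put the quotients within [eps / 2] of the Jacobian,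
   and make [C * e] at most [eps / 2]. *)
pose e := Num.min (d / 2) (Num.min (r / 2) (eps / K)).
have e0 : 0 < e by rewrite !lt_min !divr_gt0.
have ed : e < d by apply: (@le_lt_trans _ _ (d / 2)); [rewrite ge_min lexx|lra].
have er : e < r.
  by apply: (@le_lt_trans _ _ (r / 2)); [rewrite !ge_min lexx orbT|lra].
have eK : e <= eps / K by rewrite !ge_min lexx !orbT.
have {}HC := HC e; rewrite e0 ed in HC; have {}HC := HC isT.
have {}D := D e; have {}D : `|jacobian f g (x, y) -
   ((f (x + e, y) - f (x, y)) / e * ((g (x, y + e) - g (x, y)) / e) -
    (g (x + e, y) - g (x, y)) / e * ((f (x, y + e) - f (x, y)) / e))| < eps / 2.
  apply: D; last by rewrite gt_eqF.
  by rewrite -ball_normE /= sub0r normrN gtr0_norm.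
move: HC; rewrite /gap1 /gap2 -E.
have -> : (x, y) + (e, 0) = (x + e, y) :> R * R by congr (_, _); rewrite addr0.
have -> : (x, y) + (0, e) = (x, y + e) :> R * R by congr (_, _); rewrite addr0.
rewrite -/(f (x + e, y)) -/(g (x + e, y)) -/(f (x, y + e)) -/(g (x, y + e)).
rewrite -/(f (x, y)) -/(g (x, y)).
move: D; move: (f (x, y)) (f (x + e, y)) (f (x, y + e)).
move: (g (x, y)) (g (x + e, y)) (g (x, y + e)) (jacobian f g (x, y)).
move=> g0 g1 g2 J f0 f1 f2 D HC.
set Q := (X in `|J - X|) in D.
have {}HC : `|Q - 1| <= eps / 2.
  have -> : Q - 1 = ((f1 - f0) * (g2 - g0) - (g1 - g0) * (f2 - f0) - e ^+ 2) / e ^+ 2.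
    by rewrite /Q; field; rewrite gt_eqF.
  rewrite normrM normfV (@ger0_norm _ (e ^+ 2)) ?sqr_ge0 //.
  rewrite ler_pdivrMr ?exprn_gt0 //; apply: le_trans HC _.
  rewrite exprS mulrA ler_pM2r ?exprn_gt0 //.
  move: eK; rewrite ler_pdivlMr // /K.
  have := ler_wpM2r (ltW e0) (ler_norm C); lra.
have -> : J - 1 = (J - Q) + (Q - 1) by lra.
apply: le_trans (ler_normD _ _) _; lra.
Qed.

(** By the chain rule applied to [phi (psi z) = z], the product of the two Jacobians is 1. *)
Lemma inverse_jacobian (phi psi : R * R -> R * R) z : smooth phi -> smooth psi ->
  cancel psi phi ->
  jacobian (fun z => (phi z).1) (fun z => (phi z).2) (psi z) = 1 ->
  jacobian (fun z => (psi z).1) (fun z => (psi z).2) z = 1.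
Proof.
move=> sphi spsi psiK.
have sf := smooth_fst _ sphi; have sg := smooth_snd _ sphi.
have sp := smooth_fst _ spsi; have sq := smooth_snd _ spsi.
move: sf sg sp sq; rewrite /jacobian.
set f := fun z => (phi z).1; set g := fun z => (phi z).2.
set p := fun z => (psi z).1; set q := fun z => (psi z).2 => sf sg sp sq.
have fpq w : f (p w, q w) = w.1 by rewrite /f /p /q -surjective_pairing psiK.
have gpq w : g (p w, q w) = w.2 by rewrite /g /p /q -surjective_pairing psiK.
rewrite (surjective_pairing (psi z)) -/(p z) -/(q z).
have dif (h : R * R -> R) w : smooth h -> differentiable h w by exact: smooth_differentiable.
case: z => x y.
have X (h : R * R -> R) : smooth h -> is_derive x 1 (fun u => h (p (u, y), q (u, y)))
    (dx p (x, y) * dx h (p (x, y), q (x, y)) + dx q (x, y) * dy h (p (x, y), q (x, y))).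
  move=> sh; apply: (is_derive_plane h (fun u => p (u, y)) (fun u => q (u, y))).
  - exact: dif.
  - by apply: is_derive_dx; exact: dif.
  - by apply: is_derive_dx; exact: dif.
have Y (h : R * R -> R) : smooth h -> is_derive y 1 (fun u => h (p (x, u), q (x, u)))
    (dy p (x, y) * dx h (p (x, y), q (x, y)) + dy q (x, y) * dy h (p (x, y), q (x, y))).
  move=> sh; apply: (is_derive_plane h (fun u => p (x, u)) (fun u => q (x, u))).
  - exact: dif.
  - by apply: is_derive_dy; exact: dif.
  - by apply: is_derive_dy; exact: dif.
have E1 := @derive_val _ _ _ _ _ _ _ (X f sf).
have E2 := @derive_val _ _ _ _ _ _ _ (X g sg).
have E3 := @derive_val _ _ _ _ _ _ _ (Y f sf).
have E4 := @derive_val _ _ _ _ _ _ _ (Y g sg).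
have fX : (fun u => f (p (u, y), q (u, y))) = id by apply/funext => u; rewrite fpq.
have gX : (fun u => g (p (u, y), q (u, y))) = cst y by apply/funext => u; rewrite gpq.
have fY : (fun u => f (p (x, u), q (x, u))) = cst x by apply/funext => u; rewrite fpq.
have gY : (fun u => g (p (x, u), q (x, u))) = id by apply/funext => u; rewrite gpq.
rewrite fX derive_id in E1; rewrite gX derive_cst in E2.
rewrite fY derive_cst in E3; rewrite gY derive_id in E4.
move: E1 E2 E3 E4.
move: (dx p (x, y)) (dy p (x, y)) (dx q (x, y)) (dy q (x, y)).
move: (dx f _) (dy f _) (dx g _) (dy g _) => a b c d px py qx qy E1 E2 E3 E4 J.
have : 1 * 1 - 0 * 0 = (px * qy - qx * py) * (a * d - c * b).
  by rewrite {1}E1 {1}E4 {1}E2 {1}E3; ring.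
by rewrite J mulr1 mul0r subr0 mulr1 => <-.
Qed.

End Plane.

(** * Integrals, circulation and winding *)

Section Integral.
Variable R : realType.
Notation mu := (@lebesgue_measure R).
Implicit Types f g P : R -> R.

Lemma continuous_integrable f (a b : R) : continuous f ->
  mu.-integrable `[a, b] (EFin \o f).
Proof.
move=> cf; apply: continuous_compact_integrable; first exact: segment_compact.
exact: continuous_subspaceT.
Qed.

Lemma antiderivative f : continuous f ->
  exists P, forall x : R, 0 <= x -> is_derive x 1 P (f x).
Proof.
(* The integral starts at -1 so that 0 is an interior point and the derivative there is
   two-sided. *)
move=> cf; exists (fun x => \int[mu]_(t in `[(-1), x]) f t) => x x0.
have [||||d E] := @continuous_FTC1_closed R f (- 1) x (x + 1).
- by rewrite ltrDl.
- exact: continuous_integrable.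
- by apply: lt_le_trans x0; rewrite ltrN10.
- exact: cf.
by apply: DeriveDef; [exact: d|rewrite -derive1E; exact: E].
Qed.

Lemma FTC2 f P (a b : R) : a < b -> continuous f ->
  (forall x, a <= x <= b -> is_derive x 1 P (f x)) ->
  \int[mu]_(x in `[a, b]) f x = P b - P a.
Proof.
move=> ab cf dP; rewrite /Rintegral (@continuous_FTC2 R f P) //.
- exact: continuous_subspaceT.
- have cP x : a <= x <= b -> {for x, continuous P}.
    by move=> /dP; exact: is_derive_continuous.
  split.
  + by move=> x; rewrite in_itv /= => /andP[ax xb];
      have [|//] := dP x; rewrite !ltW.
  + apply: cvg_at_right_filter; apply: cP; rewrite lexx ltW //.
  + apply: cvg_at_left_filter; apply: cP; rewrite lexx ltW //.
- move=> x; rewrite in_itv /= => /andP[ax xb].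
  rewrite derive1E; apply: derive_val; apply: dP; rewrite !ltW //.
Qed.

End Integral.

Section ContinuousOps.
Variables (R : realType) (T : topologicalType).
Implicit Types f g : T -> R.

Lemma cts_add f g : continuous f -> continuous g -> continuous (fun x => f x + g x).
Proof. by move=> cf cg x; apply: cvgD; [exact: cf|exact: cg]. Qed.

Lemma cts_sub f g : continuous f -> continuous g -> continuous (fun x => f x - g x).
Proof. by move=> cf cg x; apply: cvgB; [exact: cf|exact: cg]. Qed.

Lemma cts_mul f g : continuous f -> continuous g -> continuous (fun x => f x * g x).
Proof. by move=> cf cg x; apply: cvgM; [exact: cf|exact: cg]. Qed.

Lemma cts_comp (U : topologicalType) (h : T -> U) (k : U -> R) :
  continuous h -> continuous k -> continuous (fun x => k (h x)).
Proof. by move=> ch ck x; apply: (@continuous_comp _ _ _ h k); [exact: ch|exact: ck]. Qed.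

End ContinuousOps.
Arguments cts_add {R T f g}.
Arguments cts_sub {R T f g}.
Arguments cts_mul {R T f g}.

Lemma cts_pair {T U V : topologicalType} {f : T -> U} {g : T -> V} :
  continuous f -> continuous g -> continuous (fun x => (f x, g x)).
Proof. by move=> cf cg x; exact: (cvg_pair (cf x) (cg x)). Qed.

(** * Polar coordinates, Green's theorem on circles and winding angles *)

Section Polar.
Variable R : realType.
Notation mu := (@lebesgue_measure R).

Definition polar (r t : R) : R * R := (r * cos t, r * sin t).

Lemma polar_2pi r : polar r (2 * pi) = polar r 0.
Proof. by rewrite /polar mulr_natl cos2pi sin2pi cos0 sin0. Qed.

Lemma polar_continuous : continuous (fun p : R * R => polar p.1 p.2).
Proof.
have c : continuous (fun p : R * R => p.1 * cos p.2).
  apply: cts_mul; first exact: fst_continuous.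
  exact: cts_comp (@snd_continuous _ _ _) (@continuous_cos R).
have s : continuous (fun p : R * R => p.1 * sin p.2).
  apply: cts_mul; first exact: fst_continuous.
  exact: cts_comp (@snd_continuous _ _ _) (@continuous_sin R).
exact: cts_pair.
Qed.

Lemma polar_angle_continuous r : continuous (polar r).
Proof.
move=> t; apply: (@continuous_comp _ _ _ (fun u => (r, u)) (fun p : R * R => polar p.1 p.2)).
  by apply: cts_pair; [exact: cst_continuous|by move=> ?; exact: cvg_id].
exact: polar_continuous.
Qed.

Lemma is_derive_polar_radius (f : R * R -> R) (r t : R) :
  differentiable f (polar r t) ->
  is_derive r 1 (fun r => f (polar r t))
    (cos t * dx R f (polar r t) + sin t * dy R f (polar r t)).
Proof.
move=> df; apply: (is_derive_plane R f (fun r => r * cos t) (fun r => r * sin t)) => //.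
  have := is_derive_mul (is_derive_id r 1) (is_derive_cst (cos t) r 1).
  by rewrite mul1r mulr0 addr0.
have := is_derive_mul (is_derive_id r 1) (is_derive_cst (sin t) r 1).
by rewrite mul1r mulr0 addr0.
Qed.

Lemma is_derive_polar_angle (f : R * R -> R) (r t : R) :
  differentiable f (polar r t) ->
  is_derive t 1 (fun t => f (polar r t))
    (r * - sin t * dx R f (polar r t) + r * cos t * dy R f (polar r t)).
Proof.
move=> df; apply: (is_derive_plane R f (fun t => r * cos t) (fun t => r * sin t)) => //;
  exact: is_derive_scale.
Qed.

Section Green.
Variables a b : R * R -> R.
Hypotheses (ca : C1 R a) (cb : C1 R b).

(** The line integral of [a dx + b dy] along the counterclockwise circle of radius [r], with
    [dx = - r sin t dt] and [dy = r cos t dt] substituted. *)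
Definition circulation (r : R) : R := \int[mu]_(t in `[0, 2 * pi])
  (r * (b (polar r t) * cos t - a (polar r t) * sin t)).

(** Green's theorem, differentiated in the radius. After differentiation under the integral sign,
    the integrand is [r] times the curl up to the angular derivative of a periodic function. *)
Lemma circulation_derive (r : R) : is_derive r 1 circulation
  (r * \int[mu]_(t in `[0, 2 * pi]) (dx R b (polar r t) - dy R a (polar r t))).
Proof.
have twopi : 0 < 2 * pi :> R by rewrite mulr_gt0 ?pi_gt0.
have ca0 := C1_continuous _ _ ca; have cb0 := C1_continuous _ _ cb.
have [da a1 a2] := ca; have [db b1 b2] := cb.
pose F (r t : R) := r * (b (polar r t) * cos t - a (polar r t) * sin t).
pose m r t := dx R b (polar r t) - dy R a (polar r t).
pose dF r t := b (polar r t) * cos t - a (polar r t) * sin t +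
  r * ((cos t * dx R b (polar r t) + sin t * dy R b (polar r t)) * cos t -
       (cos t * dx R a (polar r t) + sin t * dy R a (polar r t)) * sin t).
(* [dF r - r * m r] is the angular derivative of the radial component [K r],
   so its integral over a period vanishes. *)
pose K r t := a (polar r t) * cos t + b (polar r t) * sin t.
have derF (s t : R) : is_derive s 1 (F^~ t) (dF s t).
  have db' := is_derive_mul (is_derive_polar_radius _ _ _ (db (polar s t)))
     (is_derive_cst (cos t) s 1).
  have da' := is_derive_mul (is_derive_polar_radius _ _ _ (da (polar s t)))
     (is_derive_cst (sin t) s 1).
  have := is_derive_mul (is_derive_id s 1) (is_derive_sub db' da').
  by rewrite mul1r !mulr0 !addr0.
have derK (t : R) : is_derive t 1 (K r) (dF r t - r * m r t).
  have db' := is_derive_mul (is_derive_polar_angle _ _ _ (db (polar r t)))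
     (is_derive_sin t).
  have da' := is_derive_mul (is_derive_polar_angle _ _ _ (da (polar r t)))
     (is_derive_cos t).
  apply: is_derive_eq (is_derive_add da' db') _.
  rewrite /dF /m; move: (cos2Dsin2 t) (dx R a _) (dy R a _) (dx R b _) (dy R b _).
  move: (a _) (b _) (cos t) (sin t) => u v c s E ax ay bx by_.
  (* The identity holds modulo [cos ^+ 2 + sin ^+ 2 = 1]; inserting this factor by hand leaves a
     polynomial identity for [ring]. *)
  have -> : r * (bx - ay) = r * (bx - ay) * (c ^+ 2 + s ^+ 2) by rewrite E mulr1.
  by ring.
have cos2 : continuous (fun p : R * R => cos p.2).
  exact: cts_comp (@snd_continuous _ _ _) (@continuous_cos R).
have sin2 : continuous (fun p : R * R => sin p.2).
  exact: cts_comp (@snd_continuous _ _ _) (@continuous_sin R).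
have cp (f : R * R -> R) : continuous f ->
    continuous (fun p : R * R => f (polar p.1 p.2)).
  by move=> cf; exact: cts_comp polar_continuous cf.
have cF : continuous (fun p : R * R => F p.1 p.2).
  apply: cts_mul; first exact: fst_continuous.
  by apply: cts_sub; apply: cts_mul => //; exact: cp.
have cdF : continuous (fun p : R * R => dF p.1 p.2).
  apply: cts_add.
    by apply: cts_sub; apply: cts_mul => //; exact: cp.
  apply: cts_mul; first exact: fst_continuous.
  have A : continuous (fun p : R * R => cos p.2 * dx R a (polar p.1 p.2) +
      sin p.2 * dy R a (polar p.1 p.2)).
    exact: cts_add (cts_mul cos2 (cp _ a1)) (cts_mul sin2 (cp _ a2)).
  have B : continuous (fun p : R * R => cos p.2 * dx R b (polar p.1 p.2) +
      sin p.2 * dy R b (polar p.1 p.2)).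
    exact: cts_add (cts_mul cos2 (cp _ b1)) (cts_mul sin2 (cp _ b2)).
  exact: cts_sub (cts_mul B cos2) (cts_mul A sin2).
have cm : continuous (fun p : R * R => m p.1 p.2).
  exact: cts_sub (cp _ b1) (cp _ a2).
have slice (f : R -> R -> R) s : continuous (fun p : R * R => f p.1 p.2) ->
    continuous (f s).
  move=> cf; apply: (cts_comp _ _ _ (fun t => (s, t)) (fun p : R * R => f p.1 p.2)) => //.
  by apply: cts_pair; [exact: cst_continuous|by move=> ?; exact: cvg_id].
have mI : measurable (`[0, 2 * pi] : set (measurableTypeR R)) by [].
have [M M0 HM] : exists2 M : R, 0 <= M & forall x y : R, x \in `]r - 1, r + 1[ ->
    y \in `[0, 2 * pi] -> `|dF x y| <= M.
  pose B : set (R * R) := `[r - 1, r + 1] `*` `[0, 2 * pi].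
  have cB : compact B by apply: compact_setX; exact: segment_compact.
  have /compact_bounded/pinfty_ex_gt0[M M0 HM] :
      compact ((fun p : R * R => dF p.1 p.2) @` B).
    by apply: continuous_compact => //; exact: continuous_subspaceT.
  exists M; first exact: ltW.
  move=> x y xr yr; apply: HM; exists (x, y) => //; split => //=.
  by move: xr; rewrite !in_itv /= => /andP[A1 A2]; rewrite !ltW.
have E x y : partial1of2 F x y = dF x y.
  by rewrite partial1of2E; apply: derive_val.
have rI : `]r - 1, r + 1[%classic r by rewrite /= in_itv /= gtrBl ltrDl ltr01.
have intF x : `]r - 1, r + 1[%classic x -> mu.-integrable `[0, 2 * pi] (EFin \o F x).
  by move=> _; apply: continuous_integrable; exact: (slice F x cF).
have dF1 x y : `]r - 1, r + 1[%classic x -> `[0, 2 * pi]%classic y -> derivable (F^~ y) x 1.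
  by move=> _ _; case: (derF x y).
have intM : mu.-integrable `[0, 2 * pi] (EFin \o (fun=> M)).
  by apply: continuous_integrable; exact: cst_continuous.
have bM x y : `]r - 1, r + 1[%classic x -> `[0, 2 * pi]%classic y ->
    `|partial1of2 F x y| <= M.
  by move=> xr yr; rewrite E; exact: HM.
have D := @derivable_under_integral R _ _ mu F _ mI r (r - 1) (r + 1) rI intF dF1
  (fun=> M) (fun=> M0) intM bM.
have D' := @differentiation_under_integral R _ _ mu F _ mI r (r - 1) (r + 1) rI intF dF1
  (fun=> M) (fun=> M0) intM bM.
apply: DeriveDef; first exact: D.
rewrite -derive1E [LHS]D'.
have -> : (fun y => partial1of2 F^~ y r) = dF r by apply/funext => y; rewrite E.
have cdFr := slice dF r cdF; have cmr := slice m r cm.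
have cm' : continuous (fun t => r * m r t).
  exact: cts_mul (@cst_continuous _ _ _) cmr.
apply/eqP; rewrite -subr_eq0 -RintegralZl //; last exact: continuous_integrable.
rewrite -RintegralB //; [|exact: continuous_integrable|exact: continuous_integrable].
rewrite (FTC2 _ (fun t => dF r t - r * m r t) (K r) _ _ twopi).
- by rewrite /K polar_2pi mulr_natl cos2pi sin2pi cos0 sin0 subrr.
- exact: cts_sub cdFr cm'.
Qed.

End Green.

(** [P] is an antiderivative of the angular speed of the closed curve [(X, Y)], which avoids the
    origin. That the total angle is a multiple of [2 * pi] is expressed by its cosine, without an
    argument function. *)
Lemma winding (X Y X' Y' P : R -> R) (T : R) : 0 <= T ->
  (forall t : R, 0 <= t <= T -> is_derive t 1 X (X' t)) ->
  (forall t : R, 0 <= t <= T -> is_derive t 1 Y (Y' t)) ->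
  (forall t : R, 0 <= t <= T -> 0 < X t ^+ 2 + Y t ^+ 2) ->
  (forall t : R, 0 <= t <= T -> is_derive t 1 P
    ((X t * Y' t - Y t * X' t) / (X t ^+ 2 + Y t ^+ 2))) ->
  X T = X 0 -> Y T = Y 0 -> cos (P T - P 0) = 1.
Proof.
move=> T0 dX dY pos dP XT YT.
(* [B] is the inner product of the initial point with the point at time [t]
   rotated back by the angle [al t]; [B ^+ 2 / rho] is constant. *)
pose al t := P t - P 0.
pose B t := X 0 * (X t * cos (al t) + Y t * sin (al t)) +
            Y 0 * (Y t * cos (al t) - X t * sin (al t)).
pose rho t := X t ^+ 2 + Y t ^+ 2.
pose al' t := (X t * Y' t - Y t * X' t) / rho t.
pose rho' t := 2 * (X t * X' t) + 2 * (Y t * Y' t).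
have Tin0 : 0 <= (0 : R) <= T by rewrite lexx.
have TinT : 0 <= T <= T by rewrite lexx T0.
have drho (t : R) : 0 <= t <= T -> is_derive t 1 rho (rho' t).
  by move=> t0T; exact: (is_derive_add (is_derive_sqr (dX t t0T))
    (is_derive_sqr (dY t t0T))).
have dal (t : R) : 0 <= t <= T -> is_derive t 1 al (al' t).
  move=> t0T; have := is_derive_sub (dP t t0T) (is_derive_cst (P 0) t 1).
  by rewrite subr0.
have dB (t : R) : 0 <= t <= T -> is_derive t 1 B (rho' t / (2 * rho t) * B t).
  move=> t0T.
  have dc : is_derive t 1 (fun t => cos (al t)) (- sin (al t) * al' t).
    by apply: (@is_derive1_comp _ cos al); exact: dal.
  have ds : is_derive t 1 (fun t => sin (al t)) (cos (al t) * al' t).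
    by apply: (@is_derive1_comp _ sin al); exact: dal.
  have x := dX t t0T; have y := dY t t0T.
  have := is_derive_add
    (is_derive_scale _ (X 0) _ _ _ (is_derive_add
      (is_derive_mul x dc) (is_derive_mul y ds)))
    (is_derive_scale _ (Y 0) _ _ _ (is_derive_sub
      (is_derive_mul y dc) (is_derive_mul x ds))).
  move=> d; apply: is_derive_eq d _.
  have := pos t t0T; rewrite /rho' /rho /B /al' /rho.
  move: (cos _) (sin _) (X t) (Y t) (X' t) (Y' t) (X 0) (Y 0).
  move=> c s u v u' v' u0 v0 p; field; rewrite gt_eqF //.
have rhoT : rho T = rho 0 by rewrite /rho XT YT.
have B0 : B 0 = rho 0 by rewrite /B /al subrr cos0 sin0 /rho; ring.
have BT : B T = rho 0 * cos (al T).
  by rewrite /B XT YT /rho; ring.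
have rho0 : 0 < rho 0 by exact: pos.
pose Q t := B t ^+ 2 / rho t.
have dQ (t : R) : 0 <= t <= T -> is_derive t 1 Q 0.
  move=> t0T; have p := pos t t0T; have rn : rho t != 0 by rewrite gt_eqF.
  apply: is_derive_eq (is_derive_mul (is_derive_sqr (dB t t0T))
    (is_derive_inv rn (drho t t0T))) _.
  by field.
have Qt (t : R) : 0 <= t <= T -> Q t = rho 0.
  move=> /andP[t0 tT]; transitivity (Q 0); last first.
    by rewrite /Q B0 expr2 mulfK // gt_eqF.
  apply/esym/(is_derive_eq0 _ Q _ _ t0).
  by move=> x /andP[x0 xt]; apply: dQ; rewrite x0 (le_trans xt).
(* Constancy of [B ^+ 2 / rho] determines [cos (al T)] only up to sign. Since [B] never vanishes and
   is positive at 0, the value -1 is excluded. *)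
have Bn0 (t : R) : 0 <= t <= T -> B t != 0.
  move=> t0T; apply/eqP => Bt; have := Qt t t0T.
  by rewrite /Q Bt expr0n mul0r => E; rewrite -E ltxx in rho0.
have cB := is_derive_within_continuous dB.
have BTpos : 0 < B T.
  rewrite ltNge; apply/negP => BT0.
  have [|c] := @IVT R B 0 T 0 T0 cB.
    by rewrite B0 ge_min BT0 orbT le_max ltW.
  by rewrite in_itv /= => /Bn0/eqP.
have cpos : 0 < cos (al T) by move: BTpos; rewrite BT pmulr_rgt0.
have := Qt T TinT; rewrite /Q rhoT BT exprMn expr2 -mulrA => E.
have {}E : cos (al T) ^+ 2 = 1.
  have rn : rho 0 != 0 by rewrite gt_eqF.
  apply: (mulfI rn); rewrite mulr1 -[RHS]E; field; exact: rn.
by move: E; rewrite -{1}(expr1n _ 2) => /eqP; rewrite eqrXn2 // ?ltW // => /eqP.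
Qed.

(** For [0 < x < 2 * pi] the half-angle sine is positive, and [cos x = 1 - 2 * sin (x / 2) ^+ 2] is
    below 1. *)
Lemma cos1_ge2pi (x : R) : 0 < x -> cos x = 1 -> 2 * pi <= x.
Proof.
move=> x0 cx; rewrite leNgt; apply/negP => xpi.
have : 0 < sin (x / 2).
  apply: sin_gt0_pi; rewrite divr_gt0 //= ltr_pdivrMr // mulrC //.
have x2 : (x / 2) *+ 2 = x by rewrite -mulr_natr divfK.
have := cos_mulr2n (x / 2); rewrite x2 cx => E.
have := cos2Dsin2 (x / 2) => E' spos.
have : 0 < sin (x / 2) ^+ 2 by rewrite exprn_gt0.
by rewrite mulr2n in E; lra.
Qed.

Lemma cos1_sin0 (x : R) : cos x = 1 -> sin x = 0.
Proof. by move=> cx; apply: cos1sin0; rewrite cx normr1. Qed.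

Lemma cos1_sub (x y : R) : cos x = 1 -> cos y = 1 -> cos (x - y) = 1.
Proof.
by move=> cx cy; rewrite cosB cx cy (cos1_sin0 _ cx) mulr1 mul0r addr0.
Qed.

End Polar.

(** * The degree inequality *)

Section AreaDegree.
Variable R : realType.
Notation mu := (@lebesgue_measure R).
Notation C1 := (C1 R).
Notation dx := (dx R).
Notation dy := (dy R).
Notation polar := (polar R).

Lemma is_derive_exp (n : nat) (x : R) :
  is_derive x 1 (fun y : R => y ^+ n) (n%:R * x ^+ n.-1).
Proof.
have -> : (fun y : R => y ^+ n) = id ^+ n by apply/funext => y; rewrite exprfctE.
apply: is_derive_eq (is_deriveX n (is_derive_id x 1)) _.
by rewrite /GRing.scale /= mulr1.
Qed.

(** The curl of [G (rho)] times [x dy - y dx] is [2 * (G + rho * G')], here kept between 0 and 2;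
    where [rho >= sg] the form is [c] times the angle form. The limit value [c = sg] would force a
    corner of [G] at [sg], whence a sequence with [c] tending to [sg]. *)
Lemma profile (sg : R) (n : nat) : 0 < sg ->
  let c := sg * n.+1%:R / n.+2%:R in
  exists G G' : R -> R, [/\ forall x : R, 0 <= x -> is_derive x 1 G (G' x),
    continuous G',
    forall x : R, 0 <= x -> 0 <= G x + x * G' x <= 1,
    forall x : R, 0 <= x -> x < sg -> 0 < G x + x * G' x &
    forall x : R, sg <= x -> x * G x = c].
Proof.
have k0 : n.+2%:R != 0 :> R by rewrite pnatr_eq0.
have kE : n.+2%:R = n.+1%:R + 1 :> R by rewrite -natr1.
move: k0 kE; move E1 : (n.+1%:R : R) => k1; move: (n.+2%:R : R) => k2 k0 kE sg0 c.
(* With [min] and [max], one formula gives the derivative of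
   [1 - x ^+ n.+1 / (n.+2%:R * sg ^+ n.+1)] for [x <= sg] and of [c / x] for
   [x >= sg]; taking [G] as its primitive avoids gluing at [sg]. *)
pose G' x := - c * (Num.min x sg ^+ n / (sg ^+ n * Num.max x sg ^+ 2)).
have sgn : sg != 0 by rewrite gt_eqF.
have cmin : continuous (fun x : R => Num.min x sg).
  by move=> x; apply: continuous_min; [exact: cvg_id|exact: cvg_cst].
have cmax : continuous (fun x : R => Num.max x sg).
  by move=> x; apply: continuous_max; [exact: cvg_id|exact: cvg_cst].
have cG' : continuous G'.
  move=> x; apply: cvgM; first exact: cvg_cst.
  apply: cvgM.
    by apply: (@continuous_comp _ _ _ (fun x => Num.min x sg) (fun y => y ^+ n));
      [exact: cmin|exact: exprn_continuous].
  apply: cvgV.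
    by rewrite mulf_neq0 ?expf_neq0 // gt_eqF // lt_max sg0 orbT.
  apply: cvgM; first exact: cvg_cst.
  by apply: (@continuous_comp _ _ _ (fun x => Num.max x sg) (fun y => y ^+ 2));
      [exact: cmax|exact: exprn_continuous].
have [P dP] := antiderivative _ _ cG'.
(* The constant makes [G 0 = 1], in agreement with the formula on [[0, sg]]. *)
pose G x := P x - P 0 + 1.
have dG (x : R) : 0 <= x -> is_derive x 1 G (G' x).
  move=> x0; have := is_derive_add (is_derive_sub (dP x x0)
    (is_derive_cst (P 0) x 1)) (is_derive_cst (1 : R) x 1).
  by rewrite subr0 addr0.
have sgnn : sg ^+ n != 0 by rewrite expf_neq0.
have G'l (x : R) : x <= sg -> G' x = - (k1 / k2 * x ^+ n / sg ^+ n.+1).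
  move=> xs; rewrite /G' (min_idPl xs) (max_idPr xs) /c (exprS sg n).
  by field; rewrite ?k0 ?sgn ?sgnn ?expf_neq0.
have G'r (x : R) : sg <= x -> G' x = - (c / x ^+ 2).
  move=> xs; rewrite /G' (min_idPr xs) (max_idPl xs).
  by field; rewrite expf_neq0 // gt_eqF // (lt_le_trans sg0).
have Gl (x : R) : 0 <= x -> x <= sg -> G x = 1 - x ^+ n.+1 / (k2 * sg ^+ n.+1).
  move=> x0 xs.
  pose D y := G y - (1 - y ^+ n.+1 * (k2 * sg ^+ n.+1)^-1).
  have E : D 0 = D x.
    apply: is_derive_eq0 => // y /andP[y0 yx].
    have := is_derive_sub (dG y y0) (is_derive_sub
       (is_derive_cst (1 : R) y 1) (is_derive_mul (is_derive_exp n.+1 y)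
        (is_derive_cst (k2 * sg ^+ n.+1)^-1 y 1))).
    move=> d; apply: is_derive_eq d _.
    rewrite E1 G'l ?(le_trans yx) //= mulr0 addr0 sub0r exprS.
    by field; rewrite ?k0 ?sgn ?sgnn ?expf_neq0.
  by move/eqP: E; rewrite /D {1}/G subrr expr0n mul0r subr0 add0r subrr eq_sym subr_eq0 => /eqP.
have Gs : sg * G sg = c.
  rewrite Gl ?lexx ?ltW // /c kE; field.
  by rewrite -?kE ?k0 ?sgn ?sgnn ?expf_neq0.
have Gr (x : R) : sg <= x -> x * G x = c.
  move=> xs; have x0 : 0 < x by exact: lt_le_trans xs.
  pose F y := G y - c * y^-1.
  have E : F sg = F x.
    apply: is_derive_eq0 => // y /andP[sy yx].
    have y0 : 0 < y by exact: lt_le_trans sy.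
    have yn : y != 0 by rewrite gt_eqF.
    have := is_derive_sub (dG y (ltW y0))
       (is_derive_scale _ c _ _ _ (@is_derive_inv R id _ _ yn (is_derive_id y 1))).
    move=> d; apply: is_derive_eq d _.
    by rewrite G'r //=; field.
  have Gs' : G sg = c / sg by rewrite -Gs mulrAC divff // mul1r.
  move: E; rewrite /F Gs' subrr => /esym/eqP; rewrite subr_eq0 => /eqP ->.
  by rewrite mulrC divfK // gt_eqF.
exists G, G'; split=> // x x0.
- have [xs|xs] := leP x sg.
    rewrite (Gl x x0 xs) (G'l x xs).
    have -> : 1 - x ^+ n.+1 / (k2 * sg ^+ n.+1) +
      x * - (k1 / k2 * x ^+ n / sg ^+ n.+1) = 1 - (x / sg) ^+ n.+1.
      by rewrite expr_div_n kE (exprS x); field; rewrite -?kE ?k0 ?sgn ?sgnn ?expf_neq0.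
    have q0 : 0 <= x / sg by rewrite divr_ge0 // ltW.
    have q1 : x / sg <= 1 by rewrite ler_pdivrMr // mul1r.
    have := exprn_ge0 n.+1 q0; have := exprn_ile1 n.+1 q0 q1.
    by move=> A B; apply/andP; split; lra.
  have xp : 0 < x by exact: lt_trans xs.
  have -> : G x = c / x by rewrite -(Gr x (ltW xs)); field; rewrite gt_eqF.
  rewrite (G'r x (ltW xs)).
  have -> : c / x + x * - (c / x ^+ 2) = 0 by field; rewrite gt_eqF.
  by rewrite lexx ler01.
- move=> xs; rewrite (Gl x x0 (ltW xs)) (G'l x (ltW xs)).
  have -> : 1 - x ^+ n.+1 / (k2 * sg ^+ n.+1) +
    x * - (k1 / k2 * x ^+ n / sg ^+ n.+1) = 1 - (x / sg) ^+ n.+1.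
    by rewrite expr_div_n kE (exprS x); field; rewrite -?kE ?k0 ?sgn ?sgnn ?expf_neq0.
  rewrite subr_gt0 exprn_ilt1 // ?divr_ge0 ?(ltW sg0) //.
  by rewrite ltr_pdivrMr // mul1r.
Qed.

(** The angle is [acos (u / r)] in the closed upper half plane and [2 * pi] minus it below. The last
    clause serves the strict positivity of integrals, which is tested at interior angles. *)
Lemma polar_ex (u v r : R) : 0 < r -> u ^+ 2 + v ^+ 2 = r ^+ 2 ->
  exists t : R, [/\ 0 <= t <= 2 * pi, (u, v) = polar r t & v != 0 -> 0 < t < 2 * pi].
Proof.
move=> r0 E; have rn : r != 0 by rewrite gt_eqF.
pose w := u / r.
have w2 : 1 - w ^+ 2 = (v / r) ^+ 2.
  suff : v ^+ 2 = r ^+ 2 - u ^+ 2 -> 1 - w ^+ 2 = (v / r) ^+ 2.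
    by apply; lra.
  by rewrite /w !expr_div_n => ->; field.
have w1 : -1 <= w <= 1.
  have : w ^+ 2 <= 1 by rewrite -subr_ge0 w2 sqr_ge0.
  by rewrite -ler_norml -(real_normK (num_real w)) expr_le1.
have cw : cos (acos w) = w by rewrite acosK // in_itv.
have sw : sin (acos w) = `|v| / r.
  by rewrite sin_acos // w2 sqrtr_sqr normrM normfV (gtr0_norm r0).
have a0 := acos_ge0 w1; have a1 := acos_lepi w1.
have p0 := pi_gt0 R.
have ur : u = r * w by rewrite /w mulrC divfK.
have strict : v != 0 -> 0 < acos w < pi.
  move=> v0; have wlt : -1 < w < 1.
    have : w ^+ 2 < 1 by rewrite -subr_gt0 w2 exprn_even_gt0 //= mulf_neq0 ?invr_eq0.
    by rewrite -ltr_norml -(real_normK (num_real w)) expr_lt1.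
  by move: wlt => /andP[A B]; rewrite acos_gt0 ?acos_ltpi ?A ?B ?ltW.
have [v0|v0] := leP 0 v.
  exists (acos w); split.
  - by rewrite a0 /=; lra.
  - by rewrite /polar cw sw (ger0_norm v0) -ur mulrC divfK.
  - by move=> /strict /andP[-> ?] /=; lra.
exists (2 * pi - acos w); split.
- by apply/andP; split; lra.
- rewrite /polar cosB sinB mulr_natl cos2pi sin2pi cw sw (ltr0_norm v0) !mul1r !mul0r.
  by rewrite addr0 sub0r -ur; congr (_, _); field.
- by move=> /strict /andP[A B]; apply/andP; split; lra.
Qed.

(** Otherwise the nondecreasing [f] would be constant on [[a, b]], with derivative 0 at the interior
    point [c]. *)
Lemma is_derive_lt (f df : R -> R) (a b c : R) : a < c < b ->
  (forall x : R, a <= x <= b -> is_derive x 1 f (df x)) ->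
  (forall x : R, a <= x <= b -> 0 <= df x) -> 0 < df c -> f a < f b.
Proof.
move=> /andP[ac cb] d pos dc; rewrite ltNge; apply/negP => ba.
have ab : a < b by exact: lt_trans cb.
have mono (x y : R) : a <= x -> x <= y -> y <= b -> f x <= f y.
  move=> ax xy yb; apply: (is_derive_le _ _ df) => // z /andP[xz zy];
    [apply: d|apply: pos]; rewrite (le_trans ax xz) (le_trans zy yb) //.
have const (x : R) : a <= x <= b -> f x = f a.
  move=> /andP[ax xb]; apply/eqP; rewrite eq_le (mono a x) // andbT.
  by apply: le_trans ba; apply: mono.
have D : is_derive c 1 f 0.
  apply: (@derive1_at_max R f a b c (ltW ab)).
  - by move=> t; rewrite in_itv /= => /andP[A B]; have [|//] := d t; rewrite !ltW.
  - by rewrite in_itv /= ac.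
  - by move=> t; rewrite in_itv /= => /andP[A B]; rewrite !const // ?ltW.
have dc' : is_derive c 1 f (df c) by apply: d; rewrite !ltW.
by move: dc; rewrite -(@derive_val _ _ _ _ _ _ _ dc') (@derive_val _ _ _ _ _ _ _ D) ltxx.
Qed.

Lemma integral_bounds (f : R -> R) (T M : R) : 0 < T -> continuous f ->
  (forall t : R, 0 <= f t <= M) ->
  0 <= \int[mu]_(t in `[0, T]) f t <= M * T /\
  (forall t : R, 0 < t < T -> 0 < f t -> 0 < \int[mu]_(t in `[0, T]) f t).
Proof.
move=> T0 cf fb; have [P dP] := antiderivative _ _ cf.
have dP' (x : R) : 0 <= x <= T -> is_derive x 1 P (f x) by case/andP => /dP.
rewrite (FTC2 _ f P _ _ T0 cf dP').
split; last first.
  move=> t t0 ft; rewrite subr_gt0; apply: (is_derive_lt P f _ _ t) => //.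
  by move=> x _; have /andP[] := fb x.
have [c _ ->] := mean_value T0 dP'.
have /andP[A B] := fb c; rewrite subr0.
by rewrite mulr_ge0 ?(ltW T0) //= ler_wpM2r // ltW.
Qed.

(** * Pull-back of a radial 1-form under a map of Jacobian 1 *)

Section Form.
Variables (x y : R * R -> R) (G G' : R -> R).
Hypotheses (sx : smooth x) (sy : smooth y).
Hypothesis J1 : forall z, jacobian R x y z = 1.
Hypothesis dG : forall t : R, 0 <= t -> is_derive t 1 G (G' t).
Hypothesis cG' : continuous G'.

Definition rho z := x z * x z + y z * y z.
(** [form_x] and [form_y] are the coefficients of the pull-back under [(x, y)] of the 1-form
    [G (u ^+ 2 + v ^+ 2)] times [u dv - v du] on the target. *)
Definition form_x z := G (rho z) * (x z * dx y z - y z * dx x z).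
Definition form_y z := G (rho z) * (x z * dy y z - y z * dy x z).

Lemma rho_ge0 z : 0 <= rho z.
Proof. by rewrite /rho -!expr2 addr_ge0 // sqr_ge0. Qed.

Lemma rho_C1 : C1 rho.
Proof. by apply: C1D; apply: C1M; exact: smooth_C1. Qed.

Let dGrho z : is_derive (rho z) 1 G (G' (rho z)).
Proof. by apply: dG; exact: rho_ge0. Qed.

Lemma Grho_C1 : C1 (fun z => G (rho z)).
Proof. exact: C1_comp dGrho cG' rho_C1. Qed.

Let X := smooth_C1 _ _ sx.
Let Y := smooth_C1 _ _ sy.
Let Xx := smooth_C1 _ _ (smooth_dx _ _ sx).
Let Xy := smooth_C1 _ _ (smooth_dy _ _ sx).
Let Yx := smooth_C1 _ _ (smooth_dx _ _ sy).
Let Yy := smooth_C1 _ _ (smooth_dy _ _ sy).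

Lemma form_x_C1 : C1 form_x.
Proof.
exact: C1M _ _ _ Grho_C1 (C1B _ _ _ (C1M _ _ _ X Yx) (C1M _ _ _ Y Xx)).
Qed.

Lemma form_y_C1 : C1 form_y.
Proof.
exact: C1M _ _ _ Grho_C1 (C1B _ _ _ (C1M _ _ _ X Yy) (C1M _ _ _ Y Xy)).
Qed.

Let C1diff f z : C1 f -> differentiable f z. Proof. by case. Qed.

(** The mixed second derivatives [xxy] and [yxy] cancel, and the rest is a multiple of the Jacobian;
    multiplying the right-hand side by this 1 yields a polynomial identity. *)
Lemma curl_identity (xx xy yx yy u v xxy yxy g g' : R) :
  xx * yy - yx * xy = 1 ->
  (xx * u + u * xx + (yx * v + v * yx)) * g' * (u * yy - v * xy) +
    g * ((xx * yy + u * yxy) - (yx * xy + v * xxy)) -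
  ((xy * u + u * xy + (yy * v + v * yy)) * g' * (u * yx - v * xx) +
    g * ((xy * yx + u * yxy) - (yy * xx + v * xxy))) =
  2 * (g + (u * u + v * v) * g').
Proof.
move=> J; have -> : 2 * (g + (u * u + v * v) * g') =
  2 * (g + (u * u + v * v) * g') * (xx * yy - yx * xy) by rewrite J mulr1.
by ring.
Qed.

(** On the target the form has curl [2 * (G + rho * G')], and pulling back a 2-form multiplies its
    density by the Jacobian, here 1. *)
Lemma form_curl z :
  dx form_y z - dy form_x z = 2 * (G (rho z) + rho z * G' (rho z)).
Proof.
have dGz := C1diff _ z Grho_C1.
have dXYy := C1diff _ z (C1M _ _ _ X Yy); have dYXy := C1diff _ z (C1M _ _ _ Y Xy).
have dXYx := C1diff _ z (C1M _ _ _ X Yx); have dYXx := C1diff _ z (C1M _ _ _ Y Xx).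
have dX := C1diff _ z X; have dY := C1diff _ z Y.
have dXx := C1diff _ z Xx; have dXy := C1diff _ z Xy.
have dYx := C1diff _ z Yx; have dYy := C1diff _ z Yy.
have dXX := C1diff _ z (C1M _ _ _ X X); have dYY := C1diff _ z (C1M _ _ _ Y Y).
have Ex : dx rho z = dx x z * x z + x z * dx x z + (dx y z * y z + y z * dx y z).
  by rewrite /rho (dxD _ _ _ _ dXX dYY) (dxM _ _ _ _ dX dX) (dxM _ _ _ _ dY dY).
have Ey : dy rho z = dy x z * x z + x z * dy x z + (dy y z * y z + y z * dy y z).
  by rewrite /rho (dyD _ _ _ _ dXX dYY) (dyM _ _ _ _ dX dX) (dyM _ _ _ _ dY dY).
have dBy := C1diff _ z (C1B _ _ _ (C1M _ _ _ X Yy) (C1M _ _ _ Y Xy)).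
have dBx := C1diff _ z (C1B _ _ _ (C1M _ _ _ X Yx) (C1M _ _ _ Y Xx)).
have Fx : dx form_y z = dx rho z * G' (rho z) * (x z * dy y z - y z * dy x z) +
   G (rho z) * ((dx x z * dy y z + x z * dx (dy y) z) -
                (dx y z * dy x z + y z * dx (dy x) z)).
  rewrite /form_y (dxM _ _ _ _ dGz dBy) (dx_comp _ _ _ _ dGrho rho_C1).
  by rewrite (dxB _ _ _ _ dXYy dYXy) (dxM _ _ _ _ dX dYy) (dxM _ _ _ _ dY dXy).
have Fy : dy form_x z = dy rho z * G' (rho z) * (x z * dx y z - y z * dx x z) +
   G (rho z) * ((dy x z * dx y z + x z * dx (dy y) z) -
                (dy y z * dx x z + y z * dx (dy x) z)).
  rewrite /form_x (dyM _ _ _ _ dGz dBx) (dy_comp _ _ _ _ dGrho rho_C1).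
  rewrite (dyB _ _ _ _ dXYx dYXx) (dyM _ _ _ _ dX dYx) (dyM _ _ _ _ dY dXx).
  by rewrite (dxdy _ _ _ sx) (dxdy _ _ _ sy).
rewrite Fx Fy Ex Ey; exact: curl_identity (J1 z).
Qed.

(** Where [rho >= sg] the form is [c] times the angle form, so the circulation is [c] times the
    total angle swept by the image loop. *)
Lemma loop_circulation (sg c r : R) : 0 < sg ->
  (forall s : R, sg <= s -> s * G s = c) ->
  (forall t : R, sg <= rho (polar r t)) ->
  exists2 al, cos al = 1 & circulation R form_x form_y r = c * al.
Proof.
move=> sg0 Gc Hr.
have twopi : 0 < 2 * pi :> R by rewrite mulr_gt0 ?pi_gt0.
pose A t := x (polar r t); pose B t := y (polar r t).
pose A' t := r * - sin t * dx x (polar r t) + r * cos t * dy x (polar r t).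
pose B' t := r * - sin t * dx y (polar r t) + r * cos t * dy y (polar r t).
have cpol (f : R * R -> R) : continuous f -> continuous (fun t => f (polar r t)).
  by move=> cf; exact: cts_comp (@polar_angle_continuous R r) cf.
have csin : continuous (fun t : R => r * - sin t).
  move=> t; apply: cvgM; first exact: cvg_cst.
  by apply: cvgN; exact: continuous_sin.
have ccos : continuous (fun t : R => r * cos t).
  by move=> t; apply: cvgM; [exact: cvg_cst|exact: continuous_cos].
have cder (f : R * R -> R) : C1 f -> continuous
    (fun t => r * - sin t * dx f (polar r t) + r * cos t * dy f (polar r t)).
  move=> [_ c1 c2].
  exact: cts_add (cts_mul csin (cpol _ c1)) (cts_mul ccos (cpol _ c2)).
have cA := cpol _ (C1_continuous _ _ X); have cB := cpol _ (C1_continuous _ _ Y).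
have cA' := cder _ X; have cB' := cder _ Y.
have dA (t : R) : is_derive t 1 A (A' t).
  by apply: is_derive_polar_angle; exact: C1diff X.
have dB (t : R) : is_derive t 1 B (B' t).
  by apply: is_derive_polar_angle; exact: C1diff Y.
have rhoE t : A t ^+ 2 + B t ^+ 2 = rho (polar r t) by rewrite !expr2.
have pos t : 0 < A t ^+ 2 + B t ^+ 2 by rewrite rhoE (lt_le_trans sg0).
pose w t := (A t * B' t - B t * A' t) / (A t ^+ 2 + B t ^+ 2).
have cw : continuous w.
  move=> t; apply: cvgM.
    exact: (cts_sub (cts_mul cA cB') (cts_mul cB cA')).
  apply: cvgV; first by rewrite gt_eqF.
  exact: (cts_add (cts_mul cA cA) (cts_mul cB cB)).
have [P dP] := antiderivative _ _ cw.
exists (P (2 * pi) - P 0).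
  apply: (winding R A B A' B' P (2 * pi)) => //; first exact: ltW.
  - by move=> t /andP[t0 _]; exact: dP.
  - by rewrite /A polar_2pi.
  - by rewrite /B polar_2pi.
rewrite /circulation.
have E t : r * (form_y (polar r t) * cos t - form_x (polar r t) * sin t) = c * w t.
  rewrite /w rhoE /form_x /form_y -(Gc _ (Hr t)) /A' /B' /A /B.
  have := pos t; rewrite rhoE.
  move: (rho _) (G _) (dx x _) (dy x _) (dx y _) (dy y _) (x _) (y _) (cos t) (sin t).
  by move=> q g xx xy yx yy u v k s q0; field; rewrite gt_eqF.
under eq_Rintegral do rewrite E.
have cw' : continuous (fun t => c * w t).
  exact: cts_mul (@cst_continuous _ _ _) cw.
have dP' (t : R) : 0 <= t <= 2 * pi -> is_derive t 1 (fun t => c * P t) (c * w t).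
  by move=> /andP[t0 _]; apply: is_derive_scale; exact: dP.
by rewrite (FTC2 _ _ _ _ _ twopi cw' dP') mulrBr.
Qed.

End Form.

Lemma circulation0 (a b : R * R -> R) : circulation R a b 0 = 0.
Proof.
rewrite /circulation; under eq_Rintegral do rewrite mul0r.
have twopi : 0 < 2 * pi :> R by rewrite mulr_gt0 ?pi_gt0.
have c0 : continuous (fun _ : R => 0 : R) by exact: cst_continuous.
have d0 (t : R) : 0 <= t <= 2 * pi -> is_derive t 1 (fun _ : R => 0 : R) (0 : R).
  by move=> _; exact: is_derive_cst.
by rewrite (FTC2 _ _ _ _ _ twopi c0 d0) subrr.
Qed.

Lemma radial_derive_ge0 (r q : R) : 0 <= r -> q <= 2 * (2 * pi) ->
  0 <= 2 * pi * (2 * (r * 1)) - r * q.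
Proof. by move=> r0 qpi; have := ler_wpM2l r0 qpi; lra. Qed.

(** Final arithmetic of the degree inequality: [p] is [2 * pi], [i0] and [i1] are the two
    circulations, [a0] and [a1] the squared radii. *)
Lemma gap_le (p c i0 i1 a0 a1 : R) : c * p <= i1 - i0 ->
  p * a0 - i0 <= p * a1 - i1 -> p * c <= p * (a1 - a0).
Proof. lra. Qed.

(** A curl between 0 and 2 lets the circulation grow by at most [2 * pi * (r1 ^+ 2 - r0 ^+ 2)]. The
    growth is positive because the curl is positive at [z], and it is a multiple of [2 * pi * c];
    hence it is at least [2 * pi * c]. *)
Lemma area_degree_interior (x y : R * R -> R) (sg r0 r1 : R) (z : R * R) (n : nat) :
  smooth x -> smooth y -> (forall z, jacobian R x y z = 1) ->
  0 < sg -> 0 <= r0 -> r0 ^+ 2 < z.1 ^+ 2 + z.2 ^+ 2 < r1 ^+ 2 -> 0 < r1 ->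
  z.2 != 0 -> rho x y z < sg ->
  (forall t : R, sg <= rho x y (polar r1 t)) ->
  (r0 = 0 \/ forall t : R, sg <= rho x y (polar r0 t)) ->
  sg * n.+1%:R / n.+2%:R <= r1 ^+ 2 - r0 ^+ 2.
Proof.
move=> sx sy J1 sg0 r00 /andP[zr0 zr1] r10 z2 rz H1 H0.
have [G [G' [dG cG' fb fpos Gc]]] := profile sg n sg0.
set c := sg * _ / _ in Gc *.
have c0 : 0 < c by rewrite /c divr_gt0 // mulr_gt0.
have twopi : 0 < 2 * pi :> R by rewrite mulr_gt0 ?pi_gt0.
pose I r := circulation R (form_x x y G) (form_y x y G) r.
have ca := form_x_C1 x y G G' sx sy dG cG'.
have cb := form_y_C1 x y G G' sx sy dG cG'.
pose m z := 2 * (G (rho x y z) + rho x y z * G' (rho x y z)).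
have curl w : dx (form_y x y G) w - dy (form_x x y G) w = m w.
  exact: (form_curl x y G G' sx sy J1 dG cG').
pose S r := \int[mu]_(t in `[0, 2 * pi]) m (polar r t).
have dI (r : R) : is_derive r 1 I (r * S r).
  have := circulation_derive R _ _ ca cb r.
  by under eq_Rintegral do rewrite curl.
have cm r : continuous (fun t => m (polar r t)).
  have -> : (fun t => m (polar r t)) = (fun t => dx (form_y x y G) (polar r t) -
      dy (form_x x y G) (polar r t)) by apply/funext => t; rewrite curl.
  have [_ _ a2] := ca; have [_ b1 _] := cb.
  apply: cts_sub; first exact: cts_comp (@polar_angle_continuous R r) b1.
  exact: cts_comp (@polar_angle_continuous R r) a2.
have mb w : 0 <= m w <= 2.
  have /andP[A B] := fb _ (rho_ge0 x y w).
  by rewrite /m; apply/andP; split; lra.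
have Sbounds r := integral_bounds (fun t => m (polar r t)) (2 * pi) 2 twopi (cm r)
   (fun t => mb _).
have Sb r : 0 <= S r <= 2 * (2 * pi) := (Sbounds r).1.
pose s := Num.sqrt (z.1 ^+ 2 + z.2 ^+ 2).
have zpos : 0 < z.1 ^+ 2 + z.2 ^+ 2 by apply: le_lt_trans zr0; exact: sqr_ge0.
have s0 : 0 < s by rewrite sqrtr_gt0.
have s2 : z.1 ^+ 2 + z.2 ^+ 2 = s ^+ 2 by rewrite sqr_sqrtr // ltW.
have rs : r0 < s < r1.
  move: zr0 zr1; rewrite s2 !ltr_pXn2r ?nnegrE ?(ltW s0) ?(ltW r10) // => -> ->.
  by [].
have [t [_ zt /(_ z2) t01]] := polar_ex z.1 z.2 s s0 s2.
have Spos : 0 < S s.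
  apply: (Sbounds s).2 t01 _; rewrite -zt -surjective_pairing /m mulr_gt0 //.
  by apply: fpos => //; exact: rho_ge0.
have pos (r : R) : r0 <= r <= r1 -> 0 <= r * S r.
  move=> /andP[r0r _]; rewrite mulr_ge0 //; first exact: le_trans r0r.
  by have /andP[] := Sb r.
have Ilt : I r0 < I r1.
  apply: (is_derive_lt I (fun r => r * S r) _ _ s rs) => //.
  by rewrite mulr_gt0.
have Ile : 2 * pi * r0 ^+ 2 - I r0 <= 2 * pi * r1 ^+ 2 - I r1.
  have r01 : r0 <= r1 by move: rs => /andP[A B]; apply: ltW; exact: lt_trans B.
  apply: (is_derive_le _ (fun r => 2 * pi * r ^+ 2 - I r)
    (fun r => 2 * pi * (2 * (r * 1)) - r * S r) _ _ r01).
    move=> r _; apply: is_derive_sub => //.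
    by apply: is_derive_scale; apply: is_derive_sqr; exact: is_derive_id.
  move=> r /andP[r0r _]; have rp : 0 <= r by exact: le_trans r0r.
  by apply: radial_derive_ge0 => //; have /andP[] := Sb r.
have [a1 ca1 I1] := loop_circulation x y G sx sy sg c r1 sg0 Gc H1.
(* A degenerate inner circle has circulation [c * 0], so disks are treated together with annuli. *)
have [a0 ca0 I0] : exists2 al, cos al = 1 & I r0 = c * al.
  case: H0 => [->|H0]; last exact: (loop_circulation x y G sx sy sg c r0 sg0 Gc H0).
  by exists 0; [exact: cos0|rewrite /I circulation0 mulr0].
have al : 2 * pi <= a1 - a0.
  apply: cos1_ge2pi; last exact: cos1_sub.
  by move: Ilt; rewrite /I I1 -/(I r0) I0 ltr_pM2l // subr_gt0.
have := ler_wpM2l (ltW c0) al; rewrite mulrBr -I0 -I1 -/(I r1) => h.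
by rewrite -(ler_pM2l twopi); exact: gap_le h Ile.
Qed.

(** The condition on [z] is open, so [z] can be moved off the real axis and away from the centre;
    then [n] is taken large to replace [c] by its limit [sg]. *)
Lemma area_degree (x y : R * R -> R) (sg r0 r1 : R) (z : R * R) :
  smooth x -> smooth y -> (forall z, jacobian R x y z = 1) ->
  0 < sg -> 0 <= r0 -> 0 < r1 -> rho x y z < sg ->
  r0 ^+ 2 < z.1 ^+ 2 + z.2 ^+ 2 < r1 ^+ 2 \/
    r0 = 0 /\ z.1 ^+ 2 + z.2 ^+ 2 < r1 ^+ 2 ->
  (forall t : R, sg <= rho x y (polar r1 t)) ->
  (r0 = 0 \/ forall t : R, sg <= rho x y (polar r0 t)) ->
  sg <= r1 ^+ 2 - r0 ^+ 2.
Proof.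
move=> sx sy J1 sg0 r00 r10 rz zr H1 H0.
have [w [w2 rw wr]] : exists w : R * R, [/\ w.2 != 0, rho x y w < sg &
    r0 ^+ 2 < w.1 ^+ 2 + w.2 ^+ 2 < r1 ^+ 2].
  (* Off the real axis the polar angle of [w] lies in the open interval
     [(0, 2 * pi)]. *)
  have [z2|z2] := eqVneq z.2 0; last first.
    exists z; split=> //; case: zr => // -[-> ->].
    by rewrite expr0n /= andbT ltr_wpDl ?sqr_ge0 // exprn_even_gt0.
  have cr := C1_continuous _ _ (rho_C1 x y sx sy).
  have e0 : 0 < sg - rho x y z by rewrite subr_gt0.
  have /cvgrPdist_lt/(_ _ e0)/nbhs_ballP[d /= d0 D] := cr z.
  have {zr}[zr0 zr1] : r0 ^+ 2 <= z.1 ^+ 2 /\ z.1 ^+ 2 < r1 ^+ 2.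
    move: zr; rewrite z2 expr0n addr0 => -[/andP[A B]|[-> B]]; first by rewrite ltW.
    by rewrite expr0n sqr_ge0.
  pose q := r1 ^+ 2 - z.1 ^+ 2.
  have q0 : 0 < q by rewrite subr_gt0.
  (* The height [e] of the new point: [d / 2] keeps [rho] below [sg], while 1 and [q / 2] keep
     [e ^+ 2] below the margin [q] to the outer circle. *)
  pose e := Num.min 1 (Num.min (d / 2) (q / 2)).
  have ep : 0 < e by rewrite !lt_min ltr01 !divr_gt0.
  have e1 : e <= 1 by rewrite ge_min lexx.
  have ed : e <= d / 2 by rewrite !ge_min lexx orbT.
  have eq : e <= q / 2 by rewrite !ge_min lexx !orbT.
  exists (z.1, e); split=> /=; first by rewrite gt_eqF.
    have : `|rho x y z - rho x y (z.1, e)| < sg - rho x y z.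
      apply: D; split => /=; first exact: ballxx.
      rewrite -ball_normE /= z2 sub0r normrN gtr0_norm //; lra.
    by rewrite ltr_norml => /andP[A _]; lra.
  have ee : e ^+ 2 <= e by rewrite expr2 ler_piMl // ltW.
  have ee0 : 0 < e ^+ 2 by rewrite exprn_gt0.
  by move: eq; rewrite /q => eq; apply/andP; split; lra.
rewrite leNgt; apply/negP => lt.
set D := r1 ^+ 2 - r0 ^+ 2 in lt.
have sD : 0 < sg - D by rewrite subr_gt0.
(* For [n * (sg - D) > sg] the inequality [sg * (n + 1) / (n + 2) <= D] fails. *)
have [n Hn] : exists n : nat, sg / (sg - D) < n%:R.
  by exists (Num.bound (sg / (sg - D))); apply: archi_boundP; rewrite divr_ge0 // ltW.
have := area_degree_interior x y sg r0 r1 w n sx sy J1 sg0 r00 wr r10 w2 rw H1 H0.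
rewrite -/D ler_pdivrMr // => h.
move: Hn; rewrite ltr_pdivrMr // => Hn.
have E2 : n.+2%:R = n%:R + 2 :> R by rewrite -addn2 natrD.
have E1 : n.+1%:R = n%:R + 1 :> R by rewrite -addn1 natrD.
by move: h; rewrite E1 E2 => h; lra.
Qed.

End AreaDegree.

(** * Position of the image of a circle *)

Section Final.
Variable R : realType.
Notation polar := (polar R).

Definition sqnorm (z : R * R) : R := z.1 ^+ 2 + z.2 ^+ 2.

Lemma sqnorm_continuous : continuous sqnorm.
Proof.
have c1 := @fst_continuous R R R; have c2 := @snd_continuous R R R.
exact: (cts_add (cts_mul c1 c1) (cts_mul c2 c2)).
Qed.

Lemma sqnorm_ge0 z : 0 <= sqnorm z.
Proof. by rewrite addr_ge0 ?sqr_ge0. Qed.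

Lemma sqnorm_polar (r t : R) : sqnorm (polar r t) = r ^+ 2.
Proof. by rewrite /sqnorm /= !exprMn -mulrDr cos2Dsin2 mulr1. Qed.

Lemma rho_sqnorm (phi : R * R -> R * R) z :
  rho R (fun z => (phi z).1) (fun z => (phi z).2) z = sqnorm (phi z).
Proof. by rewrite /rho /sqnorm !expr2. Qed.

Lemma circle_polar (c : R) (z : R * R) : 0 < c -> sqnorm z = c ->
  exists2 t : R, 0 <= t <= 2 * pi & z = polar (Num.sqrt c) t.
Proof.
move=> c0 zc; have rc : 0 < Num.sqrt c by rewrite sqrtr_gt0.
have [|t [tt zt _]] := polar_ex R z.1 z.2 _ rc; first by rewrite sqr_sqrtr ?ltW.
by exists t => //; rewrite -zt -surjective_pairing.
Qed.

Lemma no_crossing (g : R -> R) (a b v : R) : continuous g -> a <= b ->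
  (forall t : R, a <= t <= b -> g t != v) -> (g a < v) = (g b < v).
Proof.
move=> cg ab gv.
have cross : Num.min (g a) (g b) <= v <= Num.max (g a) (g b) -> False.
  move=> h; have [c] := IVT ab (continuous_subspaceT cg) h.
  by rewrite in_itv /= => /gv/eqP.
have ga : g a != v by apply: gv; rewrite lexx.
have gb : g b != v by apply: gv; rewrite lexx ab.
apply/idP/idP => h; rewrite ltNge le_eqVlt eq_sym negb_or ?ga ?gb /=;
  apply/negP => h'; apply: cross.
  by rewrite ge_min le_max (ltW h) (ltW h') orbT.
by rewrite ge_min le_max (ltW h) (ltW h') orbT.
Qed.

(** * Sides of a circle, decided along rays *)

Section Side.
Variables (psi : R * R -> R * R) (a c : R).
Hypotheses (cpsi : continuous psi) (a0 : 0 < a).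

Let along (w : R * R) (t : R) := sqnorm (psi (t * w.1, t * w.2)).

Lemma along_continuous w : continuous (along w).
Proof.
have cl (k : R) : continuous (fun t : R => t * k).
  by move=> t; apply: cvgM; [exact: cvg_id|exact: cvg_cst].
have cp := cts_pair (cl w.1) (cl w.2).
have cq : continuous (fun t : R => psi (t * w.1, t * w.2)).
  move=> t; apply: (@continuous_comp _ _ _ (fun t : R => (t * w.1, t * w.2)) psi).
    exact: cp.
  exact: cpsi.
exact: cts_comp cq sqnorm_continuous.
Qed.

Lemma sqnorm_scale (w : R * R) (t : R) :
  sqnorm (t * w.1, t * w.2) = t ^+ 2 * sqnorm w.
Proof. by rewrite /sqnorm /= !exprMn mulrDr. Qed.

Lemma along1 w : along w 1 = sqnorm (psi w).
Proof. by rewrite /along !mul1r -surjective_pairing. Qed.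

Lemma along0 w : along w 0 = sqnorm (psi (0, 0)).
Proof. by rewrite /along !mul0r. Qed.

(** The ray from [w] outwards never leaves [sqnorm >= a], where the value [c] is not attained, and
    it ends far away, where the value exceeds [c]. *)
Lemma exterior_side (K : R) :
  (forall w, a <= sqnorm w -> sqnorm (psi w) != c) ->
  (forall w, K < sqnorm w -> c < sqnorm (psi w)) ->
  forall w, a <= sqnorm w -> c < sqnorm (psi w).
Proof.
move=> nc far w aw.
have w0 : 0 < sqnorm w by exact: lt_le_trans aw.
pose t := 1 + `|K| / sqnorm w.
have t1 : 1 <= t by rewrite lerDl divr_ge0 // ltW.
have tfar : K < t ^+ 2 * sqnorm w.
  have h : K < t * sqnorm w.
    rewrite /t mulrDl mul1r divfK ?gt_eqF //.
    by apply: le_lt_trans (ler_norm K) _; rewrite ltrDr.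
  apply: lt_le_trans h _; rewrite ler_pM2r // expr2 ler_peMl //.
  exact: le_trans t1.
have := no_crossing (along w) 1 t c (along_continuous w) t1.
rewrite along1 => E; rewrite ltNge le_eqVlt negb_or nc //=.
rewrite E; last first.
  move=> u /andP[u1 _]; apply: nc; rewrite sqnorm_scale.
  apply: le_trans aw _; rewrite ler_peMl ?(ltW w0) //.
  by rewrite expr_ge1 // (le_trans ler01).
by rewrite -leNgt ltW //; apply: far; rewrite sqnorm_scale.
Qed.

(** The disk is star-shaped about its centre, and the value [c] is not attained on the segment from
    the centre to [w]. *)
Lemma interior_side :
  (forall w, sqnorm w <= a -> sqnorm (psi w) != c) ->
  forall w, sqnorm w <= a -> (sqnorm (psi (0, 0)) < c) = (sqnorm (psi w) < c).
Proof.
move=> nc w wa.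
have := no_crossing (along w) 0 1 c (along_continuous w) ler01.
rewrite along1 along0; apply.
move=> u /andP[u0 u1]; apply: nc; rewrite sqnorm_scale.
apply: le_trans wa; rewrite ler_piMl ?sqnorm_ge0 //.
by rewrite exprn_ile1.
Qed.

End Side.

Lemma disk_image_bounded (phi : R * R -> R * R) (c : R) : continuous phi ->
  exists K : R, forall z, sqnorm z <= c -> sqnorm (phi z) <= K.
Proof.
move=> cphi.
pose M := 1 + `|c|; pose B : set (R * R) := `[- M, M] `*` `[- M, M].
have cB : compact B by apply: compact_setX; exact: segment_compact.
have cN : continuous (fun z => sqnorm (phi z)) by exact: cts_comp cphi sqnorm_continuous.
have /compact_bounded/pinfty_ex_gt0[K K0 HK] :
    compact ((fun z => sqnorm (phi z)) @` B).
  by apply: continuous_compact => //; exact: continuous_subspaceT.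
exists K => z zc.
have M1 : 1 <= M by rewrite lerDl.
have bnd (u : R) : u ^+ 2 <= c -> `|u| <= M.
  move=> uc; rewrite -(@ler_pXn2r _ 2) ?nnegrE ?(le_trans _ M1) //.
  rewrite real_normK ?num_real //; apply: le_trans uc _.
  apply: le_trans (ler_norm c) _; apply: (@le_trans _ _ M); first by rewrite lerDr.
  by rewrite expr2 ler_peMl // (le_trans ler01).
apply: le_trans (ler_norm _) _; apply: HK; exists z => //.
split => /=; rewrite in_itv /= -ler_norml; apply: bnd; apply: le_trans zc.
  by rewrite lerDl sqr_ge0.
by rewrite lerDr sqr_ge0.
Qed.

End Final.

(** * Exclusion of every position of an image circle that misses the family *)

Theorem theorem1p1 (R : realType) (s b : R) (phi : R * R -> R * R)
    (hs : 0 < s) (hb : 2 * s < b)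
    (hphi : hamiltonian_diffeomorphism phi)
    (hD : phi @` circle s `<=` open_disk b) :
  (phi @` circle s) `&` \bigcup_(t in `[s, b - s]) circle t !=set0.
Proof.
apply/set0P/eqP => E0.
have pi0 := pi_gt0 R.
(* Areas are divided by [pi], so that disks and circles become conditions on [sqnorm]. *)
pose S := s / pi; pose B := b / pi.
have S0 : 0 < S by rewrite divr_gt0.
have SB : 2 * S < B by rewrite /S /B mulrA ltr_pM2r // invr_gt0.
have [[sphi [psi [phiK psiK spsi]]] _] := hphi.
have cphi := smooth_continuous _ _ _ _ sphi.
have cpsi := smooth_continuous _ _ _ _ spsi.
have out z : sqnorm R z = S -> sqnorm R (phi z) < B /\
    ~ (S <= sqnorm R (phi z) <= B - S).
  move=> zS; have cz : circle s z.
    by rewrite /circle /= -/(sqnorm R z) zS /S mulrC divfK // gt_eqF.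
  have im : (phi @` circle s) (phi z) by exists z.
  split.
    have := hD _ im; rewrite /open_disk /= -/(sqnorm R (phi z)).
    by rewrite /B ltr_pdivlMr // mulrC.
  move=> /andP[A C]; have : (phi @` circle s `&`
      \bigcup_(t in `[s, b - s]) circle t) (phi z); last by rewrite E0.
  split=> //; exists (pi * sqnorm R (phi z)) => //=.
  rewrite in_itv /=; apply/andP; split.
    by move: A; rewrite /S ler_pdivrMr // mulrC.
  by move: C; rewrite /S /B -mulrBl ler_pdivlMr // mulrC.
pose r := Num.sqrt S.
have r0 : 0 < r by rewrite sqrtr_gt0.
have r2 : r ^+ 2 = S by rewrite sqr_sqrtr // ltW.
pose f (t : R) := sqnorm R (phi (polar R r t)).
have cf : continuous f.
  apply: cts_comp; last exact: sqnorm_continuous.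
  move=> t; apply: (@continuous_comp _ _ _ (polar R r) phi); last exact: cphi.
  exact: polar_angle_continuous.
have outf t : f t < B /\ ~ (S <= f t <= B - S) by apply: out; rewrite sqnorm_polar.
have onf z : sqnorm R z = S -> exists2 t : R, 0 <= t <= 2 * pi & sqnorm R (phi z) = f t.
  by move=> /(circle_polar R _ _ S0)[t t0 ->]; exists t.
have psi_on w : sqnorm R (psi w) = S -> exists2 t : R, 0 <= t <= 2 * pi & sqnorm R w = f t.
  by move=> /onf; rewrite psiK.
have twopi : 0 <= 2 * pi :> R by rewrite mulr_ge0 // ltW.
have [tM _ HM] := EVT_max twopi (continuous_subspaceT cf).
have [tm _ Hm] := EVT_min twopi (continuous_subspaceT cf).
have [K HK] := disk_image_bounded R phi S cphi.
have far w : K < sqnorm R w -> S < sqnorm R (psi w).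
  by move=> Kw; rewrite ltNge; apply/negP => /HK; rewrite psiK leNgt Kw.
have fx := smooth_fst R _ sphi; have fy := smooth_snd R _ sphi.
have gx := smooth_fst R _ spsi; have gy := smooth_snd R _ spsi.
have Jphi z := hamiltonian_jacobian R _ z hphi.
have Jpsi z := inverse_jacobian R _ _ z sphi spsi psiK (Jphi (psi z)).
have sq (c : R) : 0 < c -> Num.sqrt c ^+ 2 = c by move=> c0; rewrite sqr_sqrtr // ltW.
(* Beyond the image curve no point returns to the circle [sqnorm = S] under [psi], and points far
   away have preimages outside its disk. *)
have ext (a : R) : f tM < a -> forall w, a <= sqnorm R w -> S < sqnorm R (psi w).
  move=> Ma; have a0 : 0 < a by apply: le_lt_trans Ma; exact: sqnorm_ge0.
  apply: (exterior_side R psi a S cpsi a0 K) => // w aw.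
  apply/eqP => /psi_on[t t0 E]; have := HM t; rewrite in_itv /= => /(_ t0).
  by rewrite -E leNgt (lt_le_trans Ma aw).
have center : sqnorm R (psi (phi (0, 0))) = 0.
  by rewrite phiK /sqnorm /= expr0n addr0.
have center' : sqnorm R (phi (psi (0, 0))) = 0.
  by rewrite psiK /sqnorm /= expr0n addr0.
(* First case: the image curve lies in a disk of squared radius [a < S]. Its boundary is mapped by
   [psi] outside the disk [sqnorm < S], yet [phi (0, 0)] inside it goes to the centre, so the degree
   inequality gives [S <= a]. *)
have [fS|Sf] := ltP (f tM) S.
  pose a := (f tM + S) / 2.
  have fa : f tM < a by rewrite /a; lra.
  have aS : a < S by rewrite /a; lra.
  have a0 : 0 < a by apply: le_lt_trans fa; exact: sqnorm_ge0.
  have := @area_degree R _ _ S 0 (Num.sqrt a) (phi (0, 0)) gx gy Jpsi S0 (lexx 0).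
  rewrite sqrtr_gt0 a0 rho_sqnorm center sq // expr0n subr0 => /(_ isT S0) H.
  have : S <= a; last by rewrite leNgt aS.
  apply: H; last by left.
    right; split=> //; rewrite ltNge; apply/negP => /(ext _ fa).
    by rewrite center ltNge ltW.
  by move=> t; rewrite rho_sqnorm ltW // (ext _ fa) // sqnorm_polar sq.
have BSf : B - S < f tM.
  by rewrite ltNge; apply/negP => h; have [_] := outf tM; apply; rewrite Sf h.
have fne t : f t != S.
  apply/eqP => E; have [_] := outf t; apply; rewrite E lexx /=; lra.
(* The value [S] is avoided since [S < B - S]. A value at most [B - S] would lie below [S], and [f]
   would cross [S] on the way to its maximum. *)
have fgt t : B - S < f t.
  rewrite ltNge; apply/negP => h; have [_] := outf t; apply; rewrite h andbT.
  rewrite leNgt; apply/negP => ftS.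
  have [tt|tt] := leP t tM.
    have := no_crossing R f t tM S cf tt (fun u _ => fne u).
    by rewrite ftS => /esym; rewrite ltNge Sf.
  have := no_crossing R f tM t S cf (ltW tt) (fun u _ => fne u).
  by rewrite ftS ltNge Sf.
(* The image curve lies strictly between the circles of squared radii [a0] and [a1], with
   [B - S < a0] and [a1 < B]; so [a1 - a0 < S]. *)
pose a1 := (f tM + B) / 2; pose a0 := (f tm + (B - S)) / 2.
have fB := (outf tM).1; have fm := fgt tm.
have fa1 : f tM < a1 by rewrite /a1; lra.
have a1B : a1 < B by rewrite /a1; lra.
have a0f : a0 < f tm by rewrite /a0; lra.
have a0B : B - S < a0 by rewrite /a0; lra.
have a1p : 0 < a1 by apply: le_lt_trans fa1; exact: sqnorm_ge0.
have a0p : 0 < a0 by lra.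
have int w : sqnorm R w <= a0 -> sqnorm R (psi w) != S.
  move=> wa; apply/eqP => /psi_on[t t0 E]; have := Hm t; rewrite in_itv /= => /(_ t0).
  by rewrite -E leNgt (le_lt_trans wa a0f).
have side := interior_side R psi a0 S cpsi int.
(* If the preimage of the origin lies in the disk [sqnorm < S], the degree inequality for [phi] on
   this disk with threshold [a0] gives [a0 <= S], whereas [a0 > B - S > S]. *)
have [inS|outS] := ltP (sqnorm R (psi (0, 0))) S.
  have := @area_degree R _ _ a0 0 r (psi (0, 0)) fx fy Jphi a0p (lexx 0) r0.
  rewrite rho_sqnorm center' expr0n subr0 => /(_ a0p) H.
  have : a0 <= r ^+ 2; last by rewrite r2; lra.
  apply: H; last by left.
    by right; split=> //; rewrite r2.
  move=> t; rewrite rho_sqnorm.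
  have [t' t'0 ->] := onf (polar R r t) (etrans (sqnorm_polar _ _ _) r2).
  by apply: le_trans (ltW a0f) _; apply: Hm; rewrite in_itv.
(* Otherwise [psi] sends the whole disk [sqnorm <= a0] outside the disk [sqnorm < S]. Then
   [phi (0, 0)], sent to the centre, lies in the annulus between [a0] and [a1], both of whose
   boundary circles go outside; this forces [S <= a1 - a0]. *)
have := @area_degree R _ _ S (Num.sqrt a0) (Num.sqrt a1) (phi (0, 0)) gx gy Jpsi S0
  (sqrtr_ge0 _).
rewrite sqrtr_gt0 a1p rho_sqnorm center !sq // => /(_ isT S0) H.
have low w : sqnorm R w <= a0 -> S < sqnorm R (psi w).
  move=> wa; rewrite ltNge le_eqVlt negb_or int //= -side //.
  by rewrite -leNgt.
have : S <= a1 - a0; last by lra.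
apply: H.
- left; apply/andP; split; rewrite ltNge; apply/negP.
    by move=> /low; rewrite center ltNge ltW.
  by move=> /(ext _ fa1); rewrite center ltNge ltW.
- by move=> t; rewrite rho_sqnorm ltW // (ext _ fa1) // sqnorm_polar sq.
- by right=> t; rewrite rho_sqnorm ltW // low // sqnorm_polar sq.
Qed.
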